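(* The periodic Euler-Poincaré equations on $\mathbb{T}^d$ possess the following special class of periodic peakon solutions. Let $M,C\in\mathbb{R}$ be constants and let $a=(a^1,\dots,a^d)\in\mathbb{R}^d$ be a vector such that $$|a|=1\qquad\text{and}\qquad C=\frac{\cosh(\frac12)}{\sinh(\frac12)}\,M\sum_{j=1}^d a^j .$$ Let $\Phi$ be the periodic function of period $1$ given by $\Phi(z)=\frac{\cosh(\frac12-z)}{\sinh(\frac12)}$ for $z\in[0,1]$. Then $u=(u^1,\dots,u^d)$ with $$u^i(t,x)=M\,\Phi(a\cdot x-Ct)=M\,\Phi\Big(\sum_{j=1}^d a^jx^j-Ct\Big),\qquad i=1,2,\dots,d,$$ is a periodic peakon solution of the periodic Euler-Poincaré equations in the sense of distributions, that is, it is a weak solution (as defined in the context) with initial data $u_0=u(0,\cdot)$.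
   Context: Here $d$ is the spatial dimension, $|\cdot|$ is the Euclidean norm, and $\mathbb{T}^d$ is the $d$-dimensional torus (period $1$ in each coordinate). The periodic Euler-Poincaré equations for the velocity $u=(u^1,\dots,u^d)$ with momentum $m=(1-\Delta)u$ are $$\partial_t m^i+\sum_{j=1}^d u^j\partial_j m^i+\sum_{j=1}^d m^j\partial_i u^j+m^i\sum_{j=1}^d\partial_j u^j=0,\quad i=1,\dots,d,\qquad m(t,x)=m(t,x+1),$$ with initial data $m|_{t=0}=m_0$. Definition of weak solution: let $T>0$. $u\in L^\infty(0,T;H^1(\mathbb{T}^d))$ is a weak solution with initial data $u_0\in H^1(\mathbb{T}^d)$ if for every vector field $\phi\in C^1([0,T];C^\infty(\mathbb{T}^d))$ with $\phi(T,x)=0$ for all $x\in\mathbb{T}^d$, $$\int_0^T\!\!\int_{\mathbb{T}^d}\left(u\cdot\phi_t+\nabla u:\nabla\phi_t\right)dx\,dt+\int_{\mathbb{T}^d}\left(u_0\cdot\phi(0,x)+\nabla u_0:\nabla\phi(0,x)\right)dx+\int_0^T\!\!\int_{\mathbb{T}^d}T^a:\nabla\phi\,dx\,dt+\sum_{i,j,k=1}^d\int_0^T\!\!\int_{\mathbb{T}^d}u^j\,\partial_ku^i\,\partial_{jk}\phi^i\,dx\,dt=0,$$ where $T^a=u\otimes u+\nabla u(\nabla u)^T-(\nabla u)^T(\nabla u)+\frac12\left(|u|^2+|\nabla u|^2\right)\mathrm{Id}$ (the superscript $a$ in $T^a$ is only a label, unrelated to the vector $a$). Here $(\nabla u)_{ik}=\partial_ku^i$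 and $P:Q=\sum_{i,j}P_{ij}Q_{ij}$.
   Formalization: The formula for u is assumed to have period 1 in each coordinate, so that u is a function on T^d; with |a|=1 this means M=0 or a=±e_k. For other a (e.g. d=2, a=(3/5,4/5), M≠0) u is not defined on T^d and the claim fails. *)

(* Defs.v *)
From HB Require Import structures.
From mathcomp Require Import all_boot all_order all_algebra.
From mathcomp Require Import all_classical all_reals all_analysis.

Set Implicit Arguments.
Unset Strict Implicit.
Unset Printing Implicit Defensive.

Import Order.TTheory GRing.Theory Num.Theory.
Import numFieldNormedType.Exports.

Local Open Scope classical_set_scope.
Local Open Scope ring_scope.

Section torus.
Context {R : realType}.

(* Functions on T^d = R^d / Z^d are functions on R^d that have period 1 in
   each coordinate; a formula on R^d describes a function on T^d only if it has
   these periods. *)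
Record torus_map (d : nat) (V : Type) := TorusMap {
  torus_fun :> 'rV[R]_d -> V;
  torus_funP : forall x (k : 'I_d), torus_fun (x + delta_mx 0 k) = torus_fun x
}.

Definition cons_fun (d : nat) (p : measurableTypeR R * d.-tuple (measurableTypeR R))
  : d.+1.-tuple (measurableTypeR R) := [tuple of p.1 :: p.2].

Lemma measurable_cons_fun d : measurable_fun [set: _] (@cons_fun d).
Proof. exact: measurable_cons. Qed.

HB.instance Definition _ d :=
  isMeasurableFun.Build _ _ _ _ (@cons_fun d) (@measurable_cons_fun d).

(* Lebesgue measure on the period cell [0, 1]^d, as the d-fold product of
   Lebesgue measure on [0, 1] (the uniform law). *)
Fixpoint torus_measure (d : nat) : probability (d.-tuple (measurableTypeR R)) R :=
  match d with
  | 0 => \d_ [tuple]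
  | n.+1 => distribution (uniform_prob (@ltr01 R) \x torus_measure n)%E
                         (@cons_fun n)
  end.

Definition vec_of_tuple (d : nat) (x : d.-tuple (measurableTypeR R)) : 'rV[R]_d :=
  \row_i tnth x i.

Definition torus_int (d : nat) (f : 'rV[R]_d -> R) : R :=
  \int[torus_measure d]_x f (vec_of_tuple x).

Definition L2_torus (d : nat) (f : 'rV[R]_d -> R) : Prop :=
  measurable_fun setT (f \o @vec_of_tuple d) /\
  (\int[torus_measure d]_x (f (vec_of_tuple x) ^+ 2)%:E < +oo)%E.

(* Iterated partial derivatives: pd [:: j; k] f = d_j (d_k f). *)
Definition pd (d : nat) (al : seq 'I_d) (f : 'rV[R]_d -> R) : 'rV[R]_d -> R :=
  foldr (fun k g x => 'D_(delta_mx 0 k) g x) f al.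

Definition smooth (d : nat) (f : 'rV[R]_d -> R) : Prop :=
  forall al : seq 'I_d, continuous (pd al f) /\
    forall x k, derivable (pd al f) x (delta_mx 0 k).

Definition smooth_field (d : nat) (v : 'rV[R]_d -> 'rV[R]_d) : Prop :=
  forall i, smooth (fun x => v x 0 i).

(* Convergence in the Frechet space C^oo(T^d): uniform convergence of all
   partial derivatives. *)
Definition smooth_cvg (d : nat) (F : set_system R)
    (f : R -> 'rV[R]_d -> 'rV[R]_d) (g : 'rV[R]_d -> 'rV[R]_d) : Prop :=
  forall (al : seq 'I_d) (i : 'I_d) (e : R), 0 < e ->
    \forall s \near F, forall x,
      `|pd al (fun y => f s y 0 i) x - pd al (fun y => g y 0 i) x| < e.

(* phi is in C^1([0, T]; C^oo(T^d)), with time derivative phit (one-sided at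
   the endpoints), and phi(T, .) = 0. *)
Definition test_field (d : nat) (T : R) (phi phit : R -> torus_map d 'rV[R]_d)
  : Prop :=
  [/\ forall t, t \in `[0, T] -> smooth_field (phi t) /\ smooth_field (phit t),
      forall t, t \in `[0, T] ->
        smooth_cvg (within [set` `[0, T]] t^')
          (fun s x => (s - t)^-1 *: (phi s x - phi t x)) (phit t),
      forall t, t \in `[0, T] ->
        smooth_cvg (within [set` `[0, T]] (nbhs t)) phit (phit t)
    & forall x, phi T x = 0].

Definition grad (d : nat) (v : 'rV[R]_d -> 'rV[R]_d) (x : 'rV[R]_d) : 'M[R]_d :=
  \matrix_(i, k) 'D_(delta_mx 0 k) (fun y => v y 0 i) x.

(* v is in H^1(T^d) with weak gradient G, where G i k = d_k v^i. *)
Definition H1_grad (d : nat) (v : torus_map d 'rV[R]_d) (G : torus_map d 'M[R]_d)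
  : Prop :=
  [/\ forall i, L2_torus (fun x => v x 0 i),
      forall i k, L2_torus (fun x => G x i k)
    & forall (psi : torus_map d R) i k, smooth psi ->
        torus_int (fun x => v x 0 i * 'D_(delta_mx 0 k) psi x) =
        - torus_int (fun x => G x i k * psi x)].

Definition dotv (d : nat) (v w : 'rV[R]_d) : R := \sum_i v 0 i * w 0 i.

Definition ddot (d : nat) (P Q : 'M[R]_d) : R := \sum_i \sum_j P i j * Q i j.

(* The Euclidean norm; the library norm on 'rV[R]_d is the sup norm. *)
Definition enorm (d : nat) (v : 'rV[R]_d) : R := Num.sqrt (dotv v v).

Definition H1_norm (d : nat) (v : 'rV[R]_d -> 'rV[R]_d) (G : 'rV[R]_d -> 'M[R]_d)
  : R :=
  Num.sqrt (torus_int (fun x => dotv (v x) (v x) + ddot (G x) (G x))).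

(* Simple functions of t with values in H^1(T^d), together with their
   gradients. *)
Definition H1_simple (d : nat) (s : R -> 'rV[R]_d -> 'rV[R]_d)
    (S : R -> 'rV[R]_d -> 'M[R]_d) : Prop :=
  exists (m : nat) (A : 'I_m -> set (measurableTypeR R))
         (v : 'I_m -> torus_map d 'rV[R]_d) (V : 'I_m -> torus_map d 'M[R]_d),
    [/\ forall j, measurable (A j),
        forall j, H1_grad (v j) (V j),
        forall t x, s t x = \sum_j \1_(A j) t *: v j x
      & forall t x, S t x = \sum_j \1_(A j) t *: V j x].

(* u is in the Bochner space L^oo(0, T; H^1(T^d)), with weak spatial gradient G:
   u is an a.e. limit of simple functions and is essentially bounded. *)
Definition Linfty_H1 (d : nat) (T : R) (u : R -> torus_map d 'rV[R]_d)
    (G : R -> torus_map d 'M[R]_d) : Prop :=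
  [/\ {ae @lebesgue_measure R, forall t, t \in `]0, T[ -> H1_grad (u t) (G t)},
      exists (s : nat -> R -> 'rV[R]_d -> 'rV[R]_d)
             (S : nat -> R -> 'rV[R]_d -> 'M[R]_d),
        (forall n, H1_simple (s n) (S n)) /\
        {ae @lebesgue_measure R, forall t, t \in `]0, T[ ->
          H1_norm (fun x => s n t x - u t x) (fun x => S n t x - G t x)
            @[n --> \oo] --> 0}
    & exists K : R,
        {ae @lebesgue_measure R, forall t, t \in `]0, T[ ->
          H1_norm (u t) (G t) <= K}].

(* The tensor T^a at a point where the velocity is v and its gradient is G. *)
Definition stress (d : nat) (v : 'rV[R]_d) (G : 'M[R]_d) : 'M[R]_d :=
  v^T *m v + G *m G^T - G^T *m G + (2^-1 * (dotv v v + ddot G G))%:M.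

(* The weak gradients G of u and G0 of u0 are determined almost everywhere, so
   it does not matter which ones are used in the identity. *)
Definition weak_solution (d : nat) (T : R) (u0 : torus_map d 'rV[R]_d)
    (u : R -> torus_map d 'rV[R]_d) : Prop :=
  exists (G0 : torus_map d 'M[R]_d) (G : R -> torus_map d 'M[R]_d),
  [/\ H1_grad u0 G0, Linfty_H1 T u G
    & forall phi phit : R -> torus_map d 'rV[R]_d, test_field T phi phit ->
      (\int[@lebesgue_measure R]_(t in `[0, T])
         torus_int (fun x => dotv (u t x) (phit t x)
                             + ddot (G t x) (grad (phit t) x)))
      + torus_int (fun x => dotv (u0 x) (phi 0 x)
                            + ddot (G0 x) (grad (phi 0) x))
      + (\int[@lebesgue_measure R]_(t in `[0, T])
           torus_int (fun x => ddot (stress (u t x) (G t x)) (grad (phi t) x)))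
      + \sum_i \sum_j \sum_k
          (\int[@lebesgue_measure R]_(t in `[0, T])
             torus_int (fun x => u t x 0 j * G t x i k
                                 * pd [:: j; k] (fun y => phi t y 0 i) x))
      = 0].

Definition cosh (z : R) : R := (expR z + expR (- z)) / 2.

Definition sinh (z : R) : R := (expR z - expR (- z)) / 2.

Definition peakon_profile (z : R) : R :=
  cosh (2^-1 - (z - (Num.floor z)%:~R)) / sinh 2^-1.

Lemma peakon_profile_period z : peakon_profile (z + 1) = peakon_profile z.
Proof.
rewrite /peakon_profile floorDrz ?rpred1// floor1 intrD.
by rewrite (_ : z + 1 - _ = z - (Num.floor z)%:~R) // opprD addrACA subrr addr0.
Qed.

Lemma peakon_profileE z : 0 <= z <= 1 ->
  peakon_profile z = cosh (2^-1 - z) / sinh 2^-1.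
Proof.
move=> /andP[z0]; rewrite le_eqVlt => /predU1P[->|z1]; last first.
  by rewrite /peakon_profile (@floor_def _ _ 0) ?subr0// z0.
rewrite /peakon_profile floor1 subrr subr0 /cosh.
have -> : 2^-1 - 1 = - 2^-1 :> R by rewrite {2}(splitr 1) mul1r opprD addNKr.
by rewrite opprK addrC.
Qed.

End torus.

(* Main.v *)
Require Import Defs.
From HB Require Import structures.
From mathcomp Require Import all_boot all_order all_algebra.
From mathcomp Require Import all_classical all_reals all_analysis.
From mathcomp Require Import measurable_realfun.
From mathcomp Require Import ring lra.

Import Order.TTheory GRing.Theory Num.Theory.
Import numFieldNormedType.Exports.

(** Periodicity of u forces a to be an integer vector unless M = 0, and then
    |a| = 1 leaves a = ± e_m. As the profile Φ is even, all the components of u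
    are equal to w = M Φ(x_m - c t) with c = M coth(1/2). Two facts drive the
    computation: Φ' jumps by 2 at the integers, so that Φ'' = Φ - 2 δ, and
    Φ^2 - Φ'^2 is constant, which removes the part of the stress proportional
    to (w^2 - w'^2) ∂_m φ^m. Integration by parts in x_m turns the remaining
    terms into values, averaged over the other variables, of the test field on
    the crest x_m = c t; they sum to 2 M d/dt φ^i(t, c t), and the time integral
    cancels the contribution of the initial data. *)

Set Implicit Arguments.
Unset Strict Implicit.
Unset Printing Implicit Defensive.

Local Open Scope classical_set_scope.
Local Open Scope ring_scope.

(** * Integration on the torus *)

Section TorusIntegral.
Context {R : realType}.
Local Notation U01 := (uniform_prob (@ltr01 R)).
Local Notation RT := (measurableTypeR R).

(** The speed is dictated by the jump of [w w']. Off the crest [(w w')' = w^2 + w'^2], so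
    integrating the cubic term [w w' ∂_mm φ^i] by parts gives minus the integral of
    [(w^2 + w'^2) ∂_m φ^i], which is exactly what survives of the stress, plus the jump [2 M^2 Φ(0)]
    times the crest mean of [∂_m φ^i]. This jump is the [2 M c] required by the chain rule along the
    moving crest precisely because [c = M Φ(0)]. The integrals of [(w^2 + w'^2) ∂_m φ^i] cancel
    without being computed, but only once the time integrals are split, so each of them must be
    integrable in time. This is delicate because [w'] is discontinuous. The sum [w^2 + w'^2] is
    nevertheless Lipschitz: [w'] takes the opposite values [M] and [-M] on the two sides of the
    crest, and squaring erases the jump. *)

Definition upd_tuple d (k : 'I_d) (p : d.-tuple RT * RT) : d.-tuple RT :=
  [tuple if i == k then p.2 else tnth p.1 i | i < d].

(** Measurability is joint in the point and the new coordinate, as Tonelli's theorem demands; this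
    is why [upd_tuple] takes a pair. *)
Lemma measurable_upd_tuple d (k : 'I_d) : measurable_fun setT (upd_tuple k).
Proof.
apply/measurable_fun_tnthP => i.
rewrite (_ : _ \o _ = fun p => if i == k then p.2 else tnth p.1 i); last first.
  by apply/funext => p /=; rewrite tnth_mktuple.
case: (i == k); first exact: measurable_snd.
apply: (@measurableT_comp _ _ _ _ _ _ (fun x : d.-tuple RT => tnth x i)) => //.
exact: measurable_tnth.
Qed.

Lemma upd_tuple_cons0 d (z y : RT) (x : d.-tuple RT) :
  upd_tuple ord0 (cons_fun (z, x), y) = cons_fun (y, x).
Proof.
apply: eq_from_tnth => i; rewrite tnth_mktuple /cons_fun.
by case: (unliftP ord0 i) => [j|] ->; rewrite ?eqxx ?tnth0 //= !tnthS.
Qed.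

Lemma upd_tuple_consS d (k : 'I_d) (z y : RT) (x : d.-tuple RT) :
  upd_tuple (lift ord0 k) (cons_fun (z, x), y) = cons_fun (z, upd_tuple k (x, y)).
Proof.
apply: eq_from_tnth => i; rewrite tnth_mktuple /cons_fun.
case: (unliftP ord0 i) => [j|] ->; rewrite /= ?tnth0 //.
by rewrite !tnthS tnth_mktuple (inj_eq lift_inj).
Qed.

Local Open Scope ereal_scope.

Lemma ge0_integral_torusS d (f : d.+1.-tuple RT -> \bar R) :
  measurable_fun setT f -> (forall x, 0 <= f x) ->
  \int[torus_measure d.+1]_x f x =
  \int[U01]_z \int[torus_measure d]_x f (cons_fun (z, x)).
Proof.
move=> mf f0.
rewrite [LHS]ge0_integral_pushforward//.
rewrite preimage_setT fubini_tonelli1 => [//||x]; last exact: f0.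
exact: (measurableT_comp mf (@measurable_cons_fun R d)).
Qed.

(** The old [k]-th coordinate stays in the outer integral as an idle variable. This costs nothing
    since every factor has mass 1, and tuples need not be split at position [k]. Induction on [d]: a
    later coordinate is passed to the tail, and the head is exchanged by Tonelli. *)
Lemma ge0_integral_torus_fubini d (k : 'I_d) (f : d.-tuple RT -> \bar R) :
  measurable_fun setT f -> (forall x, 0 <= f x) ->
  \int[torus_measure d]_x f x =
  \int[torus_measure d]_x \int[U01]_y f (upd_tuple k (x, y)).
Proof.
elim: d k f => [[]//|d IH] k f mf f0.
have mfk := measurableT_comp mf (measurable_upd_tuple k).
have mg : measurable_fun setT (fun x => \int[U01]_y f (upd_tuple k (x, y))).
  apply: (@measurable_fun_fubini_tonelli_F _ _ _ _ _ U01 (f \o upd_tuple k)) => //.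
  by move=> x; exact: f0.
rewrite (ge0_integral_torusS mf f0) ge0_integral_torusS; first last.
- by move=> x; exact: integral_ge0.
- exact: mg.
have mfc := measurableT_comp mf (@measurable_cons_fun R d).
have mfz (z : RT) : measurable_fun setT (fun x : d.-tuple RT => f (cons_fun (z, x))).
  exact: (measurableT_comp mfc (measurable_pair1 z)).
case: (unliftP ord0 k) => [j|] ->.
  apply: eq_integral => z _; rewrite (IH j)//.
  apply: eq_integral => x _; apply: eq_integral => y _.
  by rewrite upd_tuple_consS.
(* Resampling the head makes the integrand independent of the old head [z], which then integrates to
   the factor 1. *)
under [RHS]eq_integral => z _.
  under eq_integral => x _ do under eq_integral => y _ do rewrite upd_tuple_cons0.
  over.
rewrite integral_cst//= probability_setT mule1.
apply: (@fubini_tonelli _ _ _ _ _ U01 (torus_measure d) (f \o @cons_fun _ d)) => //.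
by move=> x; exact: f0.
Qed.
End TorusIntegral.

(** * Bounded measurable functions and Fubini in one coordinate *)

Section BoundedMeasurable.
Context {R : realType}.
Local Notation U01 := (uniform_prob (@ltr01 R)).
Local Notation RT := (measurableTypeR R).

Definition upd d (x : 'rV[R]_d) (k : 'I_d) (y : R) : 'rV[R]_d :=
  \row_i (if i == k then y else x 0 i).

Lemma vec_upd_tuple d (k : 'I_d) (x : d.-tuple RT) (y : RT) :
  vec_of_tuple (upd_tuple k (x, y)) = upd (vec_of_tuple x) k y.
Proof. by apply/rowP => i; rewrite !mxE tnth_mktuple. Qed.

(** A class closed under sums, products and restriction to slices, and contained in L^1 because the
    measure is finite. It settles all integrability conditions on the torus. *)
Definition bounded_measurable d (f : 'rV[R]_d -> R) :=
  measurable_fun setT (f \o @vec_of_tuple R d) /\ exists K : R, forall x, `|f x| <= K.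

Lemma bm_cst d (c : R) : bounded_measurable (fun _ : 'rV[R]_d => c).
Proof. by split; [exact: measurable_cst|exists `|c|]. Qed.

Lemma bmD d (f g : 'rV[R]_d -> R) :
  bounded_measurable f -> bounded_measurable g ->
  bounded_measurable (fun x => f x + g x).
Proof.
move=> [mf [K fK]] [mg [L gL]]; split; first exact: measurable_funD.
by exists (K + L) => x; rewrite (le_trans (ler_normD _ _))// lerD.
Qed.

Lemma bmM d (f g : 'rV[R]_d -> R) :
  bounded_measurable f -> bounded_measurable g ->
  bounded_measurable (fun x => f x * g x).
Proof.
move=> [mf [K fK]] [mg [L gL]]; split; first exact: measurable_funM.
by exists (K * L) => x; rewrite normrM ler_pM.
Qed.

Lemma bmN d (f : 'rV[R]_d -> R) : bounded_measurable f -> bounded_measurable (fun x => - f x).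
Proof.
move=> [mf [K fK]]; split; first exact: measurable_funN.
by exists K => x; rewrite normrN.
Qed.

Lemma bmB d (f g : 'rV[R]_d -> R) :
  bounded_measurable f -> bounded_measurable g ->
  bounded_measurable (fun x => f x - g x).
Proof. by move=> bf bg; apply: bmD => //; exact: bmN. Qed.

Lemma bm_sum d (I : Type) (r : seq I) (f : I -> 'rV[R]_d -> R) :
  (forall i, bounded_measurable (f i)) -> bounded_measurable (fun x => \sum_(i <- r) f i x).
Proof.
move=> bf; elim: r => [|i r IH].
  by under eq_fun do rewrite big_nil; exact: bm_cst.
by under eq_fun do rewrite big_cons; exact: bmD.
Qed.

Lemma bm_coord d (k : 'I_d) (h : R -> R) (K : R) :
  measurable_fun setT h -> (forall y, `|h y| <= K) -> bounded_measurable (fun x => h (x 0 k)).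
Proof.
move=> mh hK; split; last by exists K.
rewrite (_ : _ \o _ = h \o (fun x : d.-tuple RT => tnth x k)); last first.
  by apply/funext => x /=; rewrite mxE.
by apply: measurableT_comp => //; exact: measurable_tnth.
Qed.

Lemma bm_upd d (k : 'I_d) (f : 'rV[R]_d -> R) y :
  bounded_measurable f -> bounded_measurable (fun x => f (upd x k y)).
Proof.
move=> [mf [K fK]]; split; last by exists K.
rewrite (_ : _ \o _ = (f \o @vec_of_tuple R d) \o (@upd_tuple R d k \o pair^~ y)).
  apply: (measurableT_comp mf (measurableT_comp (measurable_upd_tuple k) _)).
  exact: measurable_pair2.
by apply/funext => x /=; rewrite vec_upd_tuple.
Qed.

Lemma bm_integrable d (f : 'rV[R]_d -> R) : bounded_measurable f ->
  (torus_measure d).-integrable setT (EFin \o (f \o @vec_of_tuple R d)).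
Proof.
move=> [mf [K fK]]; apply: measurable_bounded_integrable => //.
  by rewrite [X in (X < _)%E]probability_setT ltry.
exists K; split; first exact: num_real.
by move=> L KL x _ /=; exact: le_trans (fK _) (ltW KL).
Qed.

Lemma eq_torus_int d (f g : 'rV[R]_d -> R) : f =1 g -> torus_int f = torus_int g.
Proof. by move=> /funext ->. Qed.

Lemma torus_intD d (f g : 'rV[R]_d -> R) : bounded_measurable f -> bounded_measurable g ->
  torus_int (fun x => f x + g x) = torus_int f + torus_int g.
Proof.
by move=> bf bg; rewrite /torus_int; apply: RintegralD => //; exact: bm_integrable.
Qed.

Lemma torus_intB d (f g : 'rV[R]_d -> R) : bounded_measurable f -> bounded_measurable g ->
  torus_int (fun x => f x - g x) = torus_int f - torus_int g.
Proof.
by move=> bf bg; rewrite /torus_int; apply: RintegralB => //; exact: bm_integrable.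
Qed.

Lemma torus_intZ d (c : R) (f : 'rV[R]_d -> R) : bounded_measurable f ->
  torus_int (fun x => c * f x) = c * torus_int f.
Proof.
by move=> bf; rewrite /torus_int; apply: RintegralZl => //; exact: bm_integrable.
Qed.

Lemma torus_int_cst d (c : R) : torus_int (fun _ : 'rV[R]_d => c) = c.
Proof.
by rewrite /torus_int Rintegral_cst// [X in fine X]probability_setT mulr1.
Qed.

Lemma torus_int_sum d (I : Type) (r : seq I) (f : I -> 'rV[R]_d -> R) :
  (forall i, bounded_measurable (f i)) ->
  torus_int (fun x => \sum_(i <- r) f i x) = \sum_(i <- r) torus_int (f i).
Proof.
move=> bf; elim: r => [|i r IH].
  by rewrite big_nil; under eq_torus_int do rewrite big_nil; rewrite torus_int_cst.
under eq_torus_int do rewrite big_cons.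
by rewrite big_cons torus_intD ?IH//; exact: bm_sum.
Qed.

Lemma le_torus_int d (f g : 'rV[R]_d -> R) : bounded_measurable f -> bounded_measurable g ->
  (forall x, f x <= g x) -> torus_int f <= torus_int g.
Proof.
by move=> bf bg fg; apply: le_Rintegral => //; exact: bm_integrable.
Qed.

Lemma torus_int_norm_le d (f : 'rV[R]_d -> R) K :
  bounded_measurable f -> (forall x, `|f x| <= K) -> `|torus_int f| <= K.
Proof.
move=> bf fK; rewrite ler_norml -{1}(torus_int_cst d (- K)) -{2}(torus_int_cst d K).
by apply/andP; split; apply: le_torus_int => //; try exact: bm_cst;
  move=> x; move: (fK x); rewrite ler_norml => /andP[].
Qed.

Lemma torus_int_fubini d (k : 'I_d) (f : 'rV[R]_d -> R) : bounded_measurable f ->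
  torus_int f =
  torus_int (fun x => \int[@lebesgue_measure R]_(y in `[0, 1]) f (upd x k y)).
Proof.
move=> bf; have [mf [K fK]] := bf.
(* Adding the bound [K] makes the integrand nonnegative, so that the Tonelli form applies. Both
   sides grow by [K], all masses being 1, and [addIr] removes it at the end. *)
have f0 x : 0 <= f x + K.
  by rewrite addrC -(opprK (f x)) subr_ge0 (le_trans _ (fK x))// -normrN ler_norm.
pose F (x : d.-tuple RT) : \bar R := (f (vec_of_tuple x) + K)%:E.
have mF : measurable_fun setT F by apply/measurable_EFinP; exact: measurable_funD.
have F0 x : (0 <= F x)%E by rewrite lee_fin f0.
pose g x := \int[@lebesgue_measure R]_(y in `[0, 1]) f (upd x k y).
have mu01 : @lebesgue_measure R `[0, 1] = 1%E.
  by rewrite lebesgue_measure_itv/= lte_fin ltr01 oppr0 adde0.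
have mFk (x : d.-tuple RT) : measurable_fun setT (fun y : RT => F (upd_tuple k (x, y))).
  exact: (measurableT_comp
    (measurableT_comp mF (measurable_upd_tuple k)) (measurable_pair1 x)).
have mfk (x : d.-tuple RT) :
    measurable_fun setT (fun y : RT => f (upd (vec_of_tuple x) k y)).
  have /measurable_EFinP/(measurable_funB (g := cst K)) := mFk x.
  move=> /(_ (measurable_cst _)); apply: eq_measurable_fun => y _ /=.
  by rewrite addrK vec_upd_tuple.
have ifk (x : d.-tuple RT) : (@lebesgue_measure R).-integrable `[0, 1]
    (EFin \o (fun y => f (upd (vec_of_tuple x) k y))).
  apply: measurable_bounded_integrable => //=.
  - by rewrite [X in (X < _)%E]mu01 ltry.
  - exact: measurable_funTS (mfk x).
  - exists K; split; first exact: num_real.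
    by move=> L KL y _ /=; exact: le_trans (fK _) (ltW KL).
have ick : (@lebesgue_measure R).-integrable `[0, 1] (EFin \o cst K).
  apply: continuous_compact_integrable; first exact: segment_compact.
  by apply: continuous_subspaceT => y; exact: cvg_cst.
have Fg (x : d.-tuple RT) :
    (\int[U01]_y F (upd_tuple k (x, y)) = (g (vec_of_tuple x) + K)%:E)%E.
  rewrite integral_uniform//.
  rewrite subr0 invr1 mul1e.
  under eq_integral do rewrite /F vec_upd_tuple.
  have m01 : measurable (`[0, 1]%classic : set RT) by [].
  have iD := integrableD m01 (ifk x) ick.
  rewrite -[LHS]fineK; last exact: integrable_fin_num iD.
  rewrite -[fine _]/(\int[@lebesgue_measure R]_(y in `[0, 1])
    (f (upd (vec_of_tuple x) k y) + K)) RintegralD//.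
  by rewrite Rintegral_cst// [X in fine X]mu01 mulr1.
(* By [Fg] the inner Tonelli integral is [g + K], so [g] inherits its measurability. *)
have bg : bounded_measurable g.
  split.
    have : measurable_fun setT (fun x : d.-tuple RT => \int[U01]_y F (upd_tuple k (x, y)))%E.
      apply: (@measurable_fun_fubini_tonelli_F _ _ _ _ _ U01 (F \o @upd_tuple R d k)) => //.
      - by apply: measurableT_comp => //; exact: measurable_upd_tuple.
      - by move=> x; exact: F0.
    under eq_fun do rewrite Fg.
    move=> /measurable_EFinP/(measurable_funB (g := cst K)).
    move=> /(_ (measurable_cst _)); apply: eq_measurable_fun => y _ /=.
    by rewrite addrK.
  exists K => x.
  have mx : measurable_fun setT (fun y : RT => f (upd x k y)).
    have := mfk [tuple x 0 i | i < d]; rewrite (_ : vec_of_tuple _ = x)//.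
    by apply/rowP => i; rewrite mxE tnth_mktuple.
  have ix := ifk [tuple x 0 i | i < d]; rewrite (_ : vec_of_tuple _ = x) in ix; last first.
    by apply/rowP => i; rewrite mxE tnth_mktuple.
  rewrite /g (le_trans (le_normr_Rintegral _ ix))//.
  rewrite (@le_trans _ _ (\int[@lebesgue_measure R]_(y in `[0, 1]) K))//.
    apply: le_Rintegral => //.
    exact: (integrable_abse ix).
  by rewrite Rintegral_cst// [X in fine X]mu01 mulr1.
apply: (addIr K).
rewrite -[X in _ + X](torus_int_cst d K) -torus_intD//; last exact: bm_cst.
rewrite -[X in _ = _ + X](torus_int_cst d K) -torus_intD//; last exact: bm_cst.
rewrite /torus_int /Rintegral; congr fine.
rewrite [LHS](ge0_integral_torus_fubini k mF F0).
by apply: eq_integral => x _; rewrite Fg.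
Qed.

End BoundedMeasurable.

(** * Lattice-periodic and smooth functions *)

Section Periodic.
Context {R : realType}.
Local Notation RT := (measurableTypeR R).

Definition fpart (z : R) : R := z - (Num.floor z)%:~R.

Lemma fpart_ge0 z : 0 <= fpart z.
Proof. by rewrite /fpart subr_ge0 ge_floor. Qed.

Lemma fpart_lt1 z : fpart z < 1.
Proof. by rewrite /fpart ltrBlDl -[X in _ + X]/(1%:~R) -intrD floorD1_gt. Qed.

Lemma fpart_itv z : fpart z \in `[0, 1].
Proof. by rewrite in_itv/= fpart_ge0 ltW ?fpart_lt1. Qed.

Lemma floor_measurable : measurable_fun setT (fun z : RT => (Num.floor z)%:~R : R).
Proof.
by apply: nondecreasing_measurable => // x y xy; rewrite ler_int; exact: le_floor.
Qed.

Lemma fpart_measurable : measurable_fun setT (fpart : RT -> R).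
Proof. by apply: measurable_funB => //; exact: floor_measurable. Qed.

(** The sigma-algebra on tuples is generated by the coordinates, whereas continuity refers to the
    topology of row vectors; rounding to a lattice, which is countable, links the two. *)
Lemma continuous_measurable_vec d (f : 'rV[R]_d -> R) : continuous f ->
  measurable_fun setT (f \o @vec_of_tuple R d).
Proof.
move=> cf.
pose z_ n (x : d.-tuple RT) : 'rV[int]_d := \row_i Num.floor (n.+1%:R * tnth x i).
pose q_ n (z : 'rV[int]_d) : 'rV[R]_d := \row_i ((z 0 i)%:~R / n.+1%:R).
(* f is the limit of functions that depend on the lattice point z_ n x only *)
apply: (@measurable_fun_cvg _ _ _ _ (fun n x => f (q_ n (z_ n x)))).
  move=> n _ Y mY; rewrite setTI.
  rewrite (_ : _ @^-1` _ = \bigcup_z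
      (if `[< Y (f (q_ n z)) >] then z_ n @^-1` [set z] else set0)); last first.
    apply/seteqP; split => [x /= Yx|x [z _]].
      by exists (z_ n x) => //; case: asboolP.
    by case: asboolP => // Yz /= ->.
  apply: countable_bigcupT_measurable => [|z]; first exact: countableP.
  case: asboolP => // _.
  rewrite (_ : _ @^-1` _ = \big[setI/setT]_(i < d)
      [set x : d.-tuple RT | (Num.floor (n.+1%:R * tnth x i))%:~R = (z 0 i)%:~R :> R]).
    apply: bigsetI_measurable => i _.
    have : measurable_fun setT
        (fun x : d.-tuple RT => (Num.floor (n.+1%:R * tnth x i))%:~R : R).
      apply: (measurableT_comp floor_measurable).
      by apply: measurable_funM => //; exact: measurable_tnth.
    by move=> /(_ measurableT [set (z 0 i)%:~R]); rewrite setTI; apply.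
  rewrite -bigcap_seq; apply/seteqP; split => [x /= <- i _ /=|x xz /=].
    by rewrite mxE.
  apply/rowP => i; rewrite mxE.
  by apply/eqP; rewrite -(eqr_int R); apply/eqP/xz; rewrite /= mem_index_enum.
move=> x _ /=.
suff : q_ n (z_ n x) @[n --> \oo] --> vec_of_tuple x.
  by move=> /(continuous_cvg _ (cf _)); apply.
apply/cvg_ballP => e e0; near=> n.
split => // i j; rewrite !mxE /ball/=.
(* The rounding error of a coordinate is the fractional part of its multiple by [n + 1], divided by
   [n + 1]. *)
rewrite -[X in X - _](mulfK (_ : n.+1%:R != 0 :> R))// -mulrBl normrM.
rewrite ger0_norm; last first.
  by rewrite subr_ge0 mulrC ge_floor.
rewrite normfV ger0_norm// ltr_pdivrMr//.
rewrite (@lt_le_trans _ _ 1)//; first by rewrite [_ * n.+1%:R]mulrC; exact: fpart_lt1.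
by rewrite -ler_pdivrMr// div1r ltW//; near: n; exact: (near_infty_natSinv_lt (PosNum e0)).
Unshelve. all: end_near. Qed.


Definition lattice_periodic d (V : Type) (f : 'rV[R]_d -> V) :=
  forall x (k : 'I_d), f (x + delta_mx 0 k) = f x.

Lemma periodicZ d V (f : 'rV[R]_d -> V) : lattice_periodic f ->
  forall x k (z : int), f (x + z%:~R *: delta_mx 0 k) = f x.
Proof.
move=> pf x k z.
have H n y : f (y + n%:R *: delta_mx 0 k) = f y.
  elim: n y => [|n IH] y; first by rewrite scale0r addr0.
  by rewrite -natr1 scalerDl scale1r addrA pf IH.
case: z => n; first exact: H.
by rewrite NegzE mulrNz scaleNr -[LHS](H n.+1) subrK.
Qed.

Lemma periodic_fpart d V (f : 'rV[R]_d -> V) : lattice_periodic f ->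
  forall x : 'rV[R]_d, f (\row_i fpart (x 0 i)) = f x.
Proof.
move=> pf x.
have H (z : 'I_d -> int) s y : f (y + \sum_(k <- s) (z k)%:~R *: delta_mx 0 k) = f y.
  elim: s y => [|k s IH] y; first by rewrite big_nil addr0.
  by rewrite big_cons addrA IH periodicZ.
rewrite -(H (fun k => Num.floor (x 0 k)) (index_enum _)); congr f.
apply/rowP => i; rewrite !mxE summxE (bigD1 i)//= !mxE !eqxx mulr1.
rewrite big1 => [|j ji]; first by rewrite addr0 subrK.
by rewrite !mxE eqxx eq_sym (negbTE ji) mulr0.
Qed.

Lemma periodic_bounded d (f : 'rV[R]_d -> R) : continuous f -> lattice_periodic f ->
  exists K : R, forall x, `|f x| <= K.
Proof.
move=> cf pf.
have /compact_bounded[K [_ fK]] :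
    compact (f @` [set v : 'rV[R]_d | forall i, v ord0 i \in `[(0 : R), (1 : R)]]).
  apply: continuous_compact; first exact: continuous_subspaceT.
  apply: (@rV_compact _ _ (fun=> `[(0 : R), (1 : R)]%classic)) => i.
  exact: segment_compact.
exists (K + 1) => x; rewrite -(periodic_fpart pf); apply: fK; first by rewrite ltrDl.
by exists (\row_i fpart (x 0 i)) => // i; rewrite mxE; exact: fpart_itv.
Qed.

Lemma bm_periodic d (f : 'rV[R]_d -> R) :
  continuous f -> lattice_periodic f -> bounded_measurable f.
Proof.
by move=> cf pf; split; [exact: continuous_measurable_vec|exact: periodic_bounded].
Qed.

Lemma pd_periodic d (f : 'rV[R]_d -> R) al : lattice_periodic f -> lattice_periodic (pd al f).
Proof.
move=> pf; elim: al => [|k al IH] //= x j.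
rewrite /derive (_ : (fun h => _) = fun h : R =>
  h^-1 *: ((pd al f \o shift x) (h *: delta_mx 0 k) - pd al f x))//.
by apply/funext => h /=; rewrite addrA !IH.
Qed.

Lemma pd_cat d (f : 'rV[R]_d -> R) al bl : pd al (pd bl f) = pd (al ++ bl) f.
Proof. by rewrite /pd foldr_cat. Qed.

Lemma smooth_pd d (f : 'rV[R]_d -> R) al : smooth f -> smooth (pd al f).
Proof. by move=> sf bl; rewrite pd_cat; exact: sf. Qed.

Lemma smooth_continuous d (f : 'rV[R]_d -> R) : smooth f -> continuous f.
Proof. by move=> /(_ [::])[]. Qed.

Lemma smooth_bm d (f : 'rV[R]_d -> R) : smooth f -> lattice_periodic f -> bounded_measurable f.
Proof. by move=> /smooth_continuous; exact: bm_periodic. Qed.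

Lemma upd_shift d (x : 'rV[R]_d) k y h :
  upd x k (h + y) = h *: delta_mx 0 k + upd x k y.
Proof.
by apply/rowP => i; rewrite !mxE eqxx/=; case: eqVneq; rewrite ?mulr1 ?mulr0 ?add0r.
Qed.

Lemma updK d (x : 'rV[R]_d) k y : upd x k y 0 k = y.
Proof. by rewrite mxE eqxx. Qed.

Lemma is_derive_upd d (f : 'rV[R]_d -> R) x k y : smooth f ->
  is_derive y (1 : R) (fun z => f (upd x k z)) (pd [:: k] f (upd x k y)).
Proof.
move=> /(_ [::])[_ /(_ (upd x k y) k)] /= df.
have E : (fun h : R => h^-1 *:
      (((fun z => f (upd x k z)) \o shift y) (h *: (1 : R)) - f (upd x k y))) =
    (fun h : R => h^-1 *: ((f \o shift (upd x k y)) (h *: delta_mx 0 k) - f (upd x k y))).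
  by apply/funext => h /=; rewrite -upd_shift [h *: 1]mulr1.
by split; [rewrite /derivable E|rewrite /derive E].
Qed.

Lemma periodic_upd d V (f : 'rV[R]_d -> V) x k y : lattice_periodic f ->
  f (upd x k (y + 1)) = f (upd x k y).
Proof. by move=> pf; rewrite addrC upd_shift addrC scale1r pf. Qed.

Lemma upd_continuous d (x : 'rV[R]_d) k : continuous (upd x k).
Proof.
move=> y; apply/cvg_ballP => e e0.
have : nbhs y (ball y e) by exact: nbhsx_ballx.
apply: filterS => z yz; split => // i j; rewrite !mxE.
by case: (j == k); [exact: yz|exact: ballxx].
Qed.

End Periodic.

(** * Integration by parts across the crest *)

Section Jump.
Context {R : realType}.
Local Notation RT := (measurableTypeR R).
Local Notation mu := (@lebesgue_measure R).

(** The derivative is carried along explicitly, so that the closure lemmas below compute it, and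
    regularity on the whole line allows the fundamental theorem on any segment. *)
Definition C1_deriv (g g' : R -> R) :=
  (forall y, is_derive y (1 : R) g (g' y)) /\ continuous g'.

Lemma C1_deriv_continuous g g' : C1_deriv g g' -> continuous g.
Proof.
move=> [dg _] y; apply: differentiable_continuous; apply/derivable1_diffP.
exact: (@ex_derive _ _ _ _ _ _ _ (dg y)).
Qed.

Lemma C1_deriv_shift g g' c : C1_deriv g g' ->
  C1_deriv (fun y => g (y + c)) (fun y => g' (y + c)).
Proof.
move=> [dg cg]; split => y.
  have dgc := dg (y + c).
  have dc : is_derive y (1 : R) (fun y => y + c) 1.
    by rewrite -[X in is_derive _ _ _ X]addr0; apply: is_deriveD.
  by rewrite -[g' _]mulr1; exact: (@is_derive1_comp _ g (fun y => y + c) y _ _ dgc dc).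
apply: (@continuous_comp _ _ _ (fun y => y + c) g'); last exact: cg.
by apply: cvgD; [exact: cvg_id|exact: cvg_cst].
Qed.

Lemma C1_derivM g g' h h' : C1_deriv g g' -> C1_deriv h h' ->
  C1_deriv (fun y => g y * h y) (fun y => g y * h' y + g' y * h y).
Proof.
move=> Cg Ch; have cg := C1_deriv_continuous Cg; have ch := C1_deriv_continuous Ch.
case: Cg Ch => [dg cg'] [dh ch']; split => y.
  have {}dg := dg y; have {}dh := dh y.
  rewrite [X in _ + X]mulrC; exact: is_deriveM.
by apply: cvgD; apply: cvgM; [exact: cg|exact: ch'|exact: cg'|exact: ch].
Qed.

Lemma Rintegral_FTC g g' a b : a <= b -> C1_deriv g g' ->
  \int[mu]_(y in `[a, b]) g' y = g b - g a.
Proof.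
rewrite le_eqVlt => /predU1P[->|ab] Cg.
  by rewrite set_itv1 Rintegral_set1 subrr.
have cg := C1_deriv_continuous Cg; case: Cg => dg cg'.
rewrite /Rintegral (@continuous_FTC2 _ g' g a b)//.
- exact: continuous_subspaceT.
- split.
  + by move=> y _; exact: (@ex_derive _ _ _ _ _ _ _ (dg y)).
  + exact: cvg_at_right_filter (cg _).
  + exact: cvg_at_left_filter (cg _).
- by move=> y _; rewrite derive1E (@derive_val _ _ _ _ _ _ _ (dg y)).
Qed.

Lemma fpart_def (z r : R) (n : int) : 0 <= r < 1 -> z = r + n%:~R -> fpart z = r.
Proof.
move=> /andP[r0 r1] ->; rewrite /fpart (@floor_def _ _ n) ?addrK//.
by rewrite lerDr r0 intrD addrC ltrD2l.
Qed.

Lemma fpart_bounded (g : R -> R) : continuous g ->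
  exists K : R, forall z, `|g (fpart z)| <= K.
Proof.
move=> cg.
have /compact_bounded[K [_ gK]] : compact (g @` `[0, 1]).
  by apply: continuous_compact; [exact: continuous_subspaceT|exact: segment_compact].
exists (K + 1) => z; apply: gK; first by rewrite ltrDl.
by exists (fpart z) => //; exact: fpart_itv.
Qed.

Lemma fpart_comp_measurable (g : R -> R) s : continuous g ->
  measurable_fun setT (fun y : RT => g (fpart (y - s))).
Proof.
move=> cg; apply: (measurableT_comp (continuous_measurable_fun cg)).
by apply: (measurableT_comp fpart_measurable); exact: measurable_funB.
Qed.

Lemma fpart_wave_bm d (k : 'I_d) g s : continuous g ->
  bounded_measurable (fun x : 'rV[R]_d => g (fpart (x 0 k - s))).
Proof.
move=> cg; have [K gK] := fpart_bounded cg.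
by apply: (bm_coord k (fpart_comp_measurable s cg)) => y; exact: gK.
Qed.

(* [g \o fpart] jumps by [g 0 - g 1] at each integer; this is where the point
   masses on the crest come from. *)
Lemma Rintegral_fpart_jump (g g' h h' : R -> R) s :
  C1_deriv g g' -> C1_deriv h h' -> (forall y, h (y + 1) = h y) ->
  \int[mu]_(y in `[0, 1]) (g (fpart (y - s)) * h' y + g' (fpart (y - s)) * h y) =
  (g 1 - g 0) * h s.
Proof.
move=> Cg Ch hper.
have hs : h s = h (fpart s).
  have H n y : h (y + n%:R) = h y.
    elim: n y => [|n IH] y; first by rewrite addr0.
    by rewrite -natr1 addrA hper IH.
  rewrite -{1}(subrK (Num.floor s)%:~R s) -/(fpart s).
  by case: (Num.floor s) => n; [rewrite H|rewrite NegzE mulrNz -[LHS](H n.+1) subrK].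
have s0 := fpart_ge0 s; have s1 := fpart_lt1 s.
have sE : s = fpart s + (Num.floor s)%:~R by rewrite /fpart subrK.
set r := fpart s in hs s0 s1 sE *.
(* The crest meets the cell at [r]. On either side of it the fractional part is a translation, so
   there the integrand is the derivative of a C^1 product. *)
have fracl y : 0 <= y < r -> fpart (y - s) = y + (1 - r).
  move=> /andP[y0 yr]; apply: (@fpart_def _ _ (- Num.floor s - 1)); first lra.
  by rewrite {1}sE intrB mulrNz; lra.
have fracr y : r <= y < 1 -> fpart (y - s) = y + (- r).
  move=> /andP[yr y1]; apply: (@fpart_def _ _ (- Num.floor s)); first lra.
  by rewrite {1}sE mulrNz; lra.
set F := (X in \int[mu]_(y in _) X y).
have Cl := C1_derivM (C1_deriv_shift (1 - r) Cg) Ch.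
have Cr := C1_derivM (C1_deriv_shift (- r) Cg) Ch.
have icont f a b : continuous f -> mu.-integrable `[a, b] (EFin \o f).
  move=> cf; apply: continuous_compact_integrable; first exact: segment_compact.
  exact: continuous_subspaceT.
(* The interval is half-open because at [r] itself the fractional part has already dropped to 0;
   only after passing to the C^1 expression may the endpoint be added. *)
have Il : \int[mu]_(y in `[0, r[) F y = g 1 * h r - g (1 - r) * h 0.
  transitivity (\int[mu]_(y in `[0, r[) (g (y + (1 - r)) * h' y + g' (y + (1 - r)) * h y)).
    by apply: eq_Rintegral => y; rewrite inE/= in_itv/= => yr; rewrite /F fracl.
  rewrite Rintegral_itv_bndo_bndc; last first.
    apply: integrableS (icont _ 0 r Cl.2) => //.
    by apply: subset_itvl; rewrite bnd_simp.
  by rewrite (Rintegral_FTC s0 Cl) add0r (_ : r + (1 - r) = 1)//; ring.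
have Ir : \int[mu]_(y in `[r, 1[) F y = g (1 - r) * h 1 - g 0 * h r.
  transitivity (\int[mu]_(y in `[r, 1[) (g (y + (- r)) * h' y + g' (y + (- r)) * h y)).
    by apply: eq_Rintegral => y; rewrite inE/= in_itv/= => yr; rewrite /F fracr.
  rewrite Rintegral_itv_bndo_bndc; last first.
    apply: integrableS (icont _ r 1 Cr.2) => //.
    by apply: subset_itvl; rewrite bnd_simp.
  by rewrite (Rintegral_FTC (ltW s1) Cr) subrr.
have [cg ch] := (C1_deriv_continuous Cg, C1_deriv_continuous Ch).
have iF : mu.-integrable `[0, 1] (EFin \o F).
  have iP (a b : R -> R) : continuous a -> continuous b ->
      mu.-integrable `[0, 1] (EFin \o (fun y => a (fpart (y - s)) * b y)).
    move=> ca cb; apply: measurable_bounded_integrable => //=.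
    - by rewrite lebesgue_measure_itv/= lte_fin ltr01 oppr0 adde0 ltry.
    - apply: measurable_funTS; apply: measurable_funM; first exact: fpart_comp_measurable.
      exact: continuous_measurable_fun.
    - have [K aK] := fpart_bounded ca.
      have /compact_bounded[L [_ bL]] : compact (b @` `[0, 1]).
        by apply: continuous_compact; [exact: continuous_subspaceT|exact: segment_compact].
      exists (K * (L + 1)); split; first exact: num_real.
      move=> B KB y y01 /=; apply: le_trans (ltW KB).
      by rewrite normrM ler_pM//; apply: bL; [rewrite ltrDl|exists y].
  exact: (integrableD _ (iP _ _ cg Ch.2) (iP _ _ Cg.2 ch)).
have split01 : `[0, 1[%classic = `[0, r[%classic `|` `[r, 1[%classic :> set R.
  by apply: itv_bndbnd_setU; rewrite bnd_simp// ltW.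
have iFo : mu.-integrable `[0, 1[ (EFin \o F).
  apply: integrableS iF => //; by apply: subset_itvl; rewrite bnd_simp.
rewrite -Rintegral_itv_bndo_bndc// split01 Rintegral_setU//=; last 2 first.
- by rewrite -split01.
- apply/disj_setPRL => y /=; rewrite !in_itv/= => /andP[ry _] /andP[_ yr].
  by move: (lt_le_trans yr ry); rewrite ltxx.
(* The terms at the ends of the cell cancel as [h 0 = h 1], leaving the two one-sided values at the
   crest. *)
rewrite Il Ir hs -[h 1](_ : h 0 = _); first by ring.
by rewrite -(add0r 1) hper.
Qed.

Lemma smooth_C1_upd d (f : 'rV[R]_d -> R) k x : smooth f ->
  C1_deriv (fun y => f (upd x k y)) (fun y => pd [:: k] f (upd x k y)).
Proof.
move=> sf; split => y; first exact: is_derive_upd.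
apply: (@continuous_comp _ _ _ (upd x k) (pd [:: k] f)); first exact: upd_continuous.
exact: smooth_continuous (smooth_pd _ sf) _.
Qed.

(** The one-dimensional jump formula on every line in direction [k], averaged over the lines. It is
    applied to three waves: [w], which has no jump and so has a weak derivative, [w'], and the
    product [w w']. *)
Lemma torus_int_fpart_jump d (k : 'I_d) g g' (f : 'rV[R]_d -> R) s :
  C1_deriv g g' -> smooth f -> lattice_periodic f ->
  torus_int (fun x => g (fpart (x 0 k - s)) * pd [:: k] f x
                      + g' (fpart (x 0 k - s)) * f x) =
  (g 1 - g 0) * torus_int (fun x => f (upd x k s)).
Proof.
move=> Cg sf pf; have cg := C1_deriv_continuous Cg.
have bd : bounded_measurable (pd [:: k] f).
  by apply: smooth_bm; [exact: smooth_pd|exact: pd_periodic].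
rewrite (torus_int_fubini k); last first.
  apply: bmD; apply: bmM => //; try exact: fpart_wave_bm.
    exact: fpart_wave_bm Cg.2.
  exact: smooth_bm.
under eq_torus_int => x.
  under eq_Rintegral => y _ do rewrite updK.
  rewrite (Rintegral_fpart_jump s Cg (smooth_C1_upd k x sf)); last first.
    by move=> y; rewrite periodic_upd.
  over.
by rewrite torus_intZ//; apply: bm_upd; exact: smooth_bm.
Qed.

(** On each line in direction [k] the factor [b] is constant and the periodic [f] has no boundary
    term. This disposes of the derivatives along the crest. *)
Lemma torus_int_pd_invariant d (k : 'I_d) (b f : 'rV[R]_d -> R) :
  bounded_measurable b -> (forall x y, b (upd x k y) = b x) ->
  smooth f -> lattice_periodic f ->
  torus_int (fun x => b x * pd [:: k] f x) = 0.
Proof.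
move=> bb bk sf pf; have bd : bounded_measurable (pd [:: k] f).
  by apply: smooth_bm; [exact: smooth_pd|exact: pd_periodic].
rewrite (torus_int_fubini k); last exact: bmM.
rewrite -[RHS](torus_int_cst d 0); apply: eq_torus_int => x.
under eq_Rintegral => y _ do rewrite bk.
rewrite RintegralZl//; last first.
  apply: continuous_compact_integrable; first exact: segment_compact.
  exact: continuous_subspaceT (smooth_C1_upd k x sf).2.
rewrite (Rintegral_FTC ler01 (smooth_C1_upd k x sf)).
by rewrite -[X in upd x k X]add0r periodic_upd// subrr mulr0.
Qed.

End Jump.

(** * The hyperbolic profile *)

Section Profile.
Context {R : realType}.
Implicit Types (g h : R -> R).

Lemma C1_derivD g g' h h' : C1_deriv g g' -> C1_deriv h h' ->
  C1_deriv (fun y => g y + h y) (fun y => g' y + h' y).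
Proof.
move=> [dg cg] [dh ch]; split => y.
  by have := dg y; have := dh y => ? ?; exact: is_deriveD.
by apply: cvgD; [exact: cg|exact: ch].
Qed.

Lemma C1_deriv_cst (c : R) : C1_deriv (fun=> c) (fun=> 0).
Proof. by split => y; [exact: is_derive_cst|exact: cvg_cst]. Qed.

Lemma C1_derivZ c g g' : C1_deriv g g' -> C1_deriv (fun y => c * g y) (fun y => c * g' y).
Proof.
move=> Cg; have := C1_derivM (C1_deriv_cst c) Cg.
by under [X in C1_deriv _ X]eq_fun do rewrite mul0r addr0.
Qed.

Lemma C1_deriv_comp_scale c g g' : C1_deriv g g' ->
  C1_deriv (fun y => g (c * y)) (fun y => c * g' (c * y)).
Proof.
move=> [dg cg]; split => y.
  have dgc := dg (c * y).
  have dc : is_derive y (1 : R) (fun y => c * y) c.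
    by rewrite -[X in is_derive _ _ _ X]mulr1; apply: is_deriveZ.
  by rewrite mulrC; exact: (@is_derive1_comp _ g (fun y => c * y) y _ _ dgc dc).
apply: cvgM; first exact: cvg_cst.
apply: (@continuous_comp _ _ _ (fun y => c * y) g'); last exact: cg.
by apply: cvgM; [exact: cvg_cst|exact: cvg_id].
Qed.

Lemma C1_deriv_expR : C1_deriv (@expR R) expR.
Proof. by split => y; [exact: is_derive_expR|exact: continuous_expR]. Qed.

Lemma sinh_half_gt0 : 0 < sinh (2^-1 : R).
Proof.
by rewrite /sinh divr_gt0// subr_gt0 ltr_expR; lra.
Qed.

(** The formula for Φ on one period, kept on the whole line, where it is smooth; periodicity and the
    corner come only from composing with [fpart]. *)
Definition profile (z : R) := cosh (2^-1 - z) / sinh 2^-1.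
Definition profile' (z : R) := - (sinh (2^-1 - z) / sinh 2^-1).

Let A : R := expR 2^-1 / 2 / sinh 2^-1.
Let B : R := expR (- 2^-1) / 2 / sinh 2^-1.

(** In terms of the two exponentials, both fixed by two differentiations, [Φ'' = Φ] off the crest
    follows from the C^1 rules. The form [-1 * z] is the one matched by the scaling rule. *)
Lemma profileE z : profile z = A * expR (-1 * z) + B * expR z.
Proof.
rewrite /profile /cosh opprB expRD [z - _]addrC expRD mulN1r /A /B.
by field; rewrite gt_eqF ?sinh_half_gt0.
Qed.

Lemma profile'E z : profile' z = A * (-1 * expR (-1 * z)) + B * expR z.
Proof.
rewrite /profile' {1}/sinh opprB expRD [z - _]addrC expRD !mulN1r /A /B.
by field; rewrite gt_eqF ?sinh_half_gt0.
Qed.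

Lemma C1_profile : C1_deriv profile profile'.
Proof.
rewrite (funext profileE) (funext profile'E).
apply: C1_derivD; apply: C1_derivZ; last exact: C1_deriv_expR.
exact: (C1_deriv_comp_scale (-1) C1_deriv_expR).
Qed.

Lemma C1_profile' : C1_deriv profile' profile.
Proof.
rewrite (funext profileE) (funext profile'E).
apply: C1_derivD; apply: C1_derivZ; last exact: C1_deriv_expR.
have := C1_derivZ (-1) (C1_deriv_comp_scale (-1) C1_deriv_expR).
by under [X in C1_deriv _ X]eq_fun do rewrite mulrA mulN1r opprK mul1r.
Qed.

Lemma profile0 : profile 0 = cosh 2^-1 / sinh 2^-1.
Proof. by rewrite /profile subr0. Qed.

Lemma half_sub1 : 2^-1 - 1 = - 2^-1 :> R.
Proof. by lra. Qed.

Lemma profile1 : profile 1 = cosh 2^-1 / sinh 2^-1.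
Proof. by rewrite /profile half_sub1 /cosh opprK addrC. Qed.

Lemma profile'0 : profile' 0 = -1.
Proof. by rewrite /profile' subr0 divff// gt_eqF// sinh_half_gt0. Qed.

Lemma profile'1 : profile' 1 = 1.
Proof.
rewrite /profile' half_sub1 {1}/sinh opprK -opprB mulNr -/(sinh _) mulNr opprK.
by rewrite divff// gt_eqF// sinh_half_gt0.
Qed.

Lemma profile_sqrB z : profile z ^+ 2 - profile' z ^+ 2 = (sinh 2^-1 ^+ 2)^-1.
Proof.
have s0 : sinh (2^-1 : R) != 0 by rewrite gt_eqF// sinh_half_gt0.
have E : cosh (2^-1 - z) ^+ 2 - sinh (2^-1 - z) ^+ 2 = 1.
  rewrite /cosh {1}/sinh.
  transitivity (expR (2^-1 - z) * expR (- (2^-1 - z))); last exact: expRxMexpNx_1.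
  by field.
rewrite /profile /profile' sqrrN !(expr_div_n _ (sinh 2^-1)) -mulrBl E div1r//.
Qed.

Lemma peakon_profile_fpart (z : R) : peakon_profile z = profile (fpart z).
Proof. by []. Qed.

Lemma fpartN (z : R) : fpart z != 0 -> fpart (- z) = 1 - fpart z.
Proof.
move=> z0; have z1 := fpart_lt1 z; have : 0 < fpart z by rewrite lt_def z0 fpart_ge0.
move=> {}z0; apply: (@fpart_def _ _ _ (- Num.floor z - 1)); first lra.
by rewrite intrB mulrNz /fpart; lra.
Qed.

Lemma profile_sym z : profile (1 - z) = profile z.
Proof.
rewrite /profile /cosh !opprB [in LHS]addrC; congr ((expR _ + expR _) / _ / _); lra.
Qed.

Lemma peakon_profileN (z : R) : peakon_profile (- z) = peakon_profile z.
Proof.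
rewrite !peakon_profile_fpart.
(* At integers the reflection rule for [fpart] fails: there both fractional parts are 0. *)
have [z0|z0] := eqVneq (fpart z) 0; last by rewrite fpartN// profile_sym.
rewrite z0 (@fpart_def _ _ 0 (- Num.floor z)) ?lexx ?ltr01//.
by rewrite add0r mulrNz; congr (- _); apply/eqP; rewrite -subr_eq0 -/(fpart z) z0.
Qed.

(** Φ attains its crest value only at integers; this is what turns the periodicity of [u] into
    integrality of [a]. *)
Lemma profile_eq0 z : 0 <= z < 1 -> profile z = profile 0 -> z = 0.
Proof.
move=> /andP[z0 z1]; rewrite /profile subr0 => /(mulIf _) H.
have {}H : cosh (2^-1 - z) = cosh 2^-1.
  by apply: H; rewrite invr_neq0// gt_eqF// sinh_half_gt0.
move: H; rewrite /cosh opprB expRD [z - _]addrC expRD => H.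
(* Equality of the two hyperbolic cosines factors into this product. The second factor vanishes only
   at [z = 1], outside the half-open period. *)
have {}H : (expR z - 1) * (expR (1 - z) - 1) = 0.
  apply/eqP; suff : expR 2^-1 * ((expR z - 1) * (expR (1 - z) - 1)) * expR (- 2^-1) == 0.
    by rewrite mulf_eq0 (gt_eqF (expR_gt0 _)) orbF mulf_eq0 (gt_eqF (expR_gt0 _)).
  have e1 : expR (1 - z) = expR 2^-1 * expR 2^-1 * expR (- z).
    by rewrite -!expRD; congr expR; lra.
  have e2 : expR 2^-1 * expR (- 2^-1) = 1 :> R by rewrite expRxMexpNx_1.
  have e3 : expR z * expR (- z) = 1 by rewrite expRxMexpNx_1.
  rewrite e1; move: H e2 e3.
  set p := expR 2^-1; set q := expR (- 2^-1); set a := expR z; set b := expR (- z).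
  move=> H e2 e3; apply/eqP.
  have -> : p * ((a - 1) * (p * p * b - 1)) * q =
    (p * q) * ((a * b) * (p * p) - p * p * b - a + 1) by ring.
  rewrite e2 e3 !mul1r.
  have {}H : p * b + q * a = p + q by lra.
  have : p * (p * b + q * a) = p * (p + q) by rewrite H.
  have -> : p * (p * b + q * a) = p * p * b + (p * q) * a by ring.
  by rewrite mulrDr e2 mul1r; lra.
move/eqP: H; rewrite mulf_eq0 !subr_eq0 => /orP[] /eqP; rewrite -[RHS]expR0 => /expR_inj; lra.
Qed.

End Profile.

(** * Means over the slices of constant [k]-th coordinate *)

Section SliceMean.
Context {R : realType}.
Local Notation mu := (@lebesgue_measure R).

(** The mean over the hyperplane where the [k]-th coordinate is [s]. That coordinate remains as an
    idle integration variable, so no torus of dimension [d - 1] appears. *)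
Definition slice_mean d (k : 'I_d) (f : 'rV[R]_d -> R) (s : R) :=
  torus_int (fun x => f (upd x k s)).

(** Locating [c] by its distance to [a] treats both orders of the endpoints at once. *)
Lemma C1_deriv_MVT (g g' : R -> R) (a b : R) : C1_deriv g g' ->
  exists2 c, `|c - a| <= `|b - a| & g b - g a = g' c * (b - a).
Proof.
move=> Cg; have cg := C1_deriv_continuous Cg; case: Cg => dg _.
have [ab|/ltW ba] := leP a b.
  have [c] := MVT_segment ab (fun y _ => dg y) (continuous_subspaceT cg).
  rewrite in_itv/= => /andP[ac cb] E; exists c => //.
  by rewrite !ger0_norm ?subr_ge0// lerB.
have [c] := MVT_segment ba (fun y _ => dg y) (continuous_subspaceT cg).
rewrite in_itv/= => /andP[bc ca] E; exists c.
  by rewrite !ler0_norm ?subr_le0// lerN2 lerB.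
by rewrite -opprB E -mulrN opprB.
Qed.

Lemma slice_mean_sub_le d (k : 'I_d) (f g : 'rV[R]_d -> R) e s :
  bounded_measurable f -> bounded_measurable g ->
  (forall x, `|f x - g x| <= e) -> `|slice_mean k f s - slice_mean k g s| <= e.
Proof.
move=> bf bg fg; rewrite /slice_mean -torus_intB; [|exact: bm_upd..].
by apply: torus_int_norm_le => //; apply: bmB; exact: bm_upd.
Qed.

Lemma pd_bm d al (f : 'rV[R]_d -> R) :
  smooth f -> lattice_periodic f -> bounded_measurable (pd al f).
Proof. by move=> sf pf; apply: smooth_bm; [exact: smooth_pd|exact: pd_periodic]. Qed.

Lemma smooth_lipschitz d (k : 'I_d) (f : 'rV[R]_d -> R) : smooth f -> lattice_periodic f ->
  exists2 L, 0 <= L & forall x s t, `|f (upd x k s) - f (upd x k t)| <= L * `|s - t|.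
Proof.
move=> sf pf; have [_ [L fL]] := pd_bm [:: k] sf pf.
exists L => [|x s t]; first exact: le_trans (fL 0).
have [c _ ->] := C1_deriv_MVT t s (smooth_C1_upd k x sf).
by rewrite normrM ler_wpM2r.
Qed.

Lemma slice_mean_lipschitz d (k : 'I_d) (f : 'rV[R]_d -> R) : smooth f -> lattice_periodic f ->
  exists2 L, 0 <= L & forall s t, `|slice_mean k f s - slice_mean k f t| <= L * `|s - t|.
Proof.
move=> sf pf; have bf := smooth_bm sf pf.
have [L L0 fL] := smooth_lipschitz k sf pf; exists L => // s t.
rewrite /slice_mean -torus_intB; [|exact: bm_upd..].
by apply: torus_int_norm_le => //; apply: bmB; exact: bm_upd.
Qed.

Lemma lipschitz_continuous_at (f : R -> R) L : 0 <= L ->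
  (forall s t, `|f s - f t| <= L * `|s - t|) -> continuous f.
Proof.
move=> L0 fL t; apply/cvgrPdist_le => e e0; near=> s.
rewrite (le_trans (fL _ _))//.
(* [L + 1] is positive even when [L = 0], so it may be divided by. *)
rewrite (@le_trans _ _ ((L + 1) * `|t - s|))// ?ler_wpM2r ?lerDl//.
rewrite mulrC -ler_pdivlMr ?ltr_wpDl//; near: s.
by apply: cvgr_dist_le; [exact: cvg_id|rewrite divr_gt0// ltr_wpDl].
Unshelve. all: end_near. Qed.

(** Differentiation under the integral: the derivative along a line is Lipschitz with a constant
    common to all lines, so the mean value theorem bounds the first-order remainder by
    [L * |s - t|^2] uniformly, and this bound survives averaging. *)
Lemma C1_slice_mean d (k : 'I_d) (f : 'rV[R]_d -> R) : smooth f -> lattice_periodic f ->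
  C1_deriv (slice_mean k f) (slice_mean k (pd [:: k] f)).
Proof.
move=> sf pf.
have [sf' pf'] : smooth (pd [:: k] f) /\ lattice_periodic (pd [:: k] f).
  by split; [exact: smooth_pd|exact: pd_periodic].
have [bf bf'] := (smooth_bm sf pf, smooth_bm sf' pf').
split; last first.
  have [L L0 fL] := slice_mean_lipschitz k sf' pf'.
  exact: lipschitz_continuous_at fL.
move=> t; have [L L0 fL] := smooth_lipschitz k sf' pf'.
have H s : `|slice_mean k f s - slice_mean k f t - (s - t) * slice_mean k (pd [:: k] f) t|
    <= L * `|s - t| ^+ 2.
  rewrite /slice_mean -torus_intB; [|exact: bm_upd..].
  rewrite -torus_intZ; last exact: bm_upd.
  have b1 : bounded_measurable (fun x => f (upd x k s) - f (upd x k t)).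
    by apply: bmB; exact: bm_upd.
  have b2 : bounded_measurable (fun x => (s - t) * pd [:: k] f (upd x k t)).
    by apply: bmM; [exact: bm_cst|exact: (bm_upd k t bf')].
  rewrite -torus_intB//; apply: torus_int_norm_le; first exact: bmB.
  move=> x; have [c ct ->] := C1_deriv_MVT t s (smooth_C1_upd k x sf).
  rewrite mulrC -mulrBr normrM mulrC expr2 mulrA ler_wpM2r//.
  by rewrite (le_trans (fL _ _ _))// ler_wpM2l.
have C : h^-1 *: ((slice_mean k f \o shift t) (h *: (1 : R)) - slice_mean k f t)
    @[h --> 0^'] --> slice_mean k (pd [:: k] f) t.
  apply/cvgrPdist_le => e e0; near=> h.
  have h0 : h != 0 by near: h; exact: nbhs_dnbhs_neq.
  rewrite /= [h *: 1]mulr1 [_ *: _]/(_ * _).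
  rewrite -[X in `|X|](mulKf h0) normrM normfV.
  rewrite mulrBr mulrA divff// mul1r distrC.
  have := H (h + t); rewrite addrK => Hh.
  rewrite mulrC ler_pdivrMr ?normr_gt0// (le_trans Hh)// expr2 mulrA ler_wpM2r//.
  rewrite (@le_trans _ _ ((L + 1) * `|h|))// ?ler_wpM2r ?lerDl//.
  rewrite mulrC -ler_pdivlMr ?ltr_wpDl// -[h]subr0 distrC; near: h.
  by apply: cvgr_dist_le; [exact: nbhs_dnbhs|rewrite divr_gt0// ltr_wpDl].
by split; [apply/cvg_ex; eexists; exact: C|exact: cvg_lim C].
Unshelve. all: end_near. Qed.

End SliceMean.

(** * Evolution along the crest *)

Section Time.
Context {R : realType}.
Local Notation mu := (@lebesgue_measure R).
Variables (d : nat) (k : 'I_d) (T : R).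
Local Notation evolution := (R -> 'rV[R]_d -> R).

Definition unif_continuous_in_time (F : evolution) :=
  forall t, t \in `[0, T] -> forall e, 0 < e ->
    \forall s \near within [set` `[0, T]] (nbhs t), forall x, `|F s x - F t x| < e.

Definition smooth_periodic (f : 'rV[R]_d -> R) := smooth f /\ lattice_periodic f.

Lemma smooth_periodic_pd al f : smooth_periodic f -> smooth_periodic (pd al f).
Proof. by move=> [sf pf]; split; [exact: smooth_pd|exact: pd_periodic]. Qed.

Lemma smooth_periodic_bm f : smooth_periodic f -> bounded_measurable f.
Proof. by move=> [sf pf]; exact: smooth_bm. Qed.

Lemma near_within (F : set_system R) {FF : Filter F} (D P : set R) :
  (\forall s \near F, P s) -> \forall s \near within D F, P s.
Proof. by move=> FP; rewrite /within /=; apply: filterS FP. Qed.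

(** Time enters through the field and through the slice. The slice is moved with the field frozen at
    [t]; then the field is changed on a fixed slice, at the cost of a sup distance. *)
Lemma slice_mean_time_continuous (F : evolution) c :
  (forall t, t \in `[0, T] -> smooth_periodic (F t)) -> unif_continuous_in_time F ->
  {within `[0, T], continuous (fun t => slice_mean k (F t) (c * t))}.
Proof.
move=> sF uF; apply/subspace_continuousP => t tT.
apply/cvgrPdist_le => e e0; have e2 : 0 < e / 2 by rewrite divr_gt0.
have cm : continuous (fun s => slice_mean k (F t) (c * s)).
  have [st pt] := sF _ tT.
  by have := C1_deriv_continuous (C1_deriv_comp_scale c (C1_slice_mean k st pt)).
have ct : \forall s \near within [set` `[0, T]] (nbhs t),
    `|slice_mean k (F t) (c * t) - slice_mean k (F t) (c * s)| <= e / 2.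
  apply: near_within.
  by apply: cvgr_dist_le; [exact: cm|].
near=> s.
have sT : s \in `[0, T] by near: s; exact: withinT.
rewrite [e]splitr -(subrKA (slice_mean k (F t) (c * s))) (le_trans (ler_normD _ _))//.
apply: lerD; first by near: s; exact: ct.
apply: slice_mean_sub_le; [exact: smooth_periodic_bm (sF _ _)..|].
move=> x; rewrite distrC; apply: ltW; move: x; near: s; exact: uF.
Unshelve. all: end_near. Qed.

Lemma pd_scaled_diff al (f g : 'rV[R]_d -> R) (c : R) : smooth f -> smooth g ->
  pd al (fun y => c * (f y - g y)) = fun y => c * (pd al f y - pd al g y).
Proof.
move=> sf sg; elim: al => [//|j al IH] /=; rewrite IH; apply/funext => x.
have [_ /(_ x j) df] := sf al; have [_ /(_ x j) dg] := sg al.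
have -> : (fun y => c * (pd al f y - pd al g y)) = c *: (pd al f - pd al g) by [].
by rewrite (deriveZ _ (derivableB df dg)) (deriveB df dg).
Qed.

(** What a test field provides for one component, with spatial derivatives taken inside the
    difference quotient. The weak identity for the wave splits into such components. *)
Record scalar_test (p q : evolution) : Prop := ScalarTest {
  scalar_test_smooth : forall t, t \in `[0, T] -> smooth_periodic (p t);
  scalar_test_smooth' : forall t, t \in `[0, T] -> smooth_periodic (q t);
  scalar_test_quotient : forall t, t \in `[0, T] -> forall al e, 0 < e ->
    \forall s \near within [set` `[0, T]] t^', forall x,
      `|(s - t)^-1 * (pd al (p s) x - pd al (p t) x) - pd al (q t) x| < e;
  scalar_test_continuous : forall al, unif_continuous_in_time (fun t => pd al (q t));
  scalar_test_final : forall x, p T x = 0 }.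

Lemma test_field_scalar (phi phit : R -> torus_map d 'rV[R]_d) i :
  test_field T phi phit ->
  scalar_test (fun t x => phi t x 0 i) (fun t x => phit t x 0 i).
Proof.
move=> [sm dq ct fin]; have sp t : t \in `[0, T] -> smooth_periodic (fun x => phi t x 0 i).
  by move=> tT; split; [exact: (sm t tT).1|move=> x j; rewrite torus_funP].
split => //.
- by move=> t tT; split; [exact: (sm t tT).2|move=> x j; rewrite torus_funP].
- move=> t tT al e e0; have Q := dq t tT al i e e0.
  have sT : \forall s \near within [set` `[0, T]] t^', s \in `[0, T] by exact: withinT.
  apply: filterS2 sT Q => s sT /[swap] x /(_ x).
  rewrite (_ : (fun y => ((s - t)^-1 *: (phi s y - phi t y)) 0 i) =
    fun y => (s - t)^-1 * (phi s y 0 i - phi t y 0 i)); last first.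
    by apply/funext => y; rewrite !mxE.
  by rewrite pd_scaled_diff//; exact: (sp _ _).1.
- by move=> al t tT e e0; exact: ct.
- by move=> x; rewrite fin mxE.
Qed.

Section ScalarTest.
Variables (p q : evolution).
Hypothesis pq : scalar_test p q.

Lemma near_dnbhs_within t (P : set R) :
  (\forall s \near within [set` `[0, T]] t^', P s) -> P t ->
  \forall s \near within [set` `[0, T]] (nbhs t), P s.
Proof.
move=> H Pt.
have {}H : nbhs t (fun s => s != t -> s \in `[0, T] -> P s) := H.
change (nbhs t (fun s => s \in `[0, T] -> P s)).
apply: filterS H => s Hs sT.
by have [->//|st] := eqVneq s t; exact: Hs.
Qed.

(** Differentiability in time forces continuity, uniformly in space: the difference quotient stays
    within 1 of the bounded function [pd al (q t)]. *)
Lemma scalar_test_unif_continuous al : unif_continuous_in_time (fun t => pd al (p t)).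
Proof.
move=> t tT e e0.
have [_ [K qK]] := smooth_periodic_bm (smooth_periodic_pd al (scalar_test_smooth' pq tT)).
have K0 : 0 <= K by exact: le_trans (qK 0).
apply: near_dnbhs_within => //; last by move=> x; rewrite subrr normr0.
near=> s => x.
have st : s != t.
  by near: s; apply: near_within; exact: nbhs_dnbhs_neq.
have st0 : s - t != 0 by rewrite subr_eq0.
have Q : `|(s - t)^-1 * (pd al (p s) x - pd al (p t) x) - pd al (q t) x| < 1.
  move: x; near: s; exact: (scalar_test_quotient pq).
have Q1 : `|(s - t)^-1 * (pd al (p s) x - pd al (p t) x)| < K + 1.
  rewrite -[X in `|X|](subrK (pd al (q t) x)) addrC.
  by rewrite (le_lt_trans (ler_normD _ _))// ler_ltD.
rewrite -[X in `|X|](mulKf st0) mulrCA normrM.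
apply: (@le_lt_trans _ _ (`|s - t| * (K + 1))); first exact: ler_wpM2l (ltW Q1).
rewrite -ltr_pdivlMr ?ltr_wpDl// distrC; near: s.
rewrite /dnbhs; do 2 apply: near_within.
by apply: cvgr_dist_lt; [exact: cvg_id|rewrite divr_gt0// ltr_wpDl].
Unshelve. all: end_near. Qed.

Lemma near_shift t (P : set R) : t \in `]0, T[ ->
  (\forall s \near within [set` `[0, T]] t^', P s) ->
  \forall h \near 0^', h + t \in `[0, T] /\ P (h + t).
Proof.
move=> tT H.
have {}H : nbhs t (fun s => s != t -> s \in `[0, T] -> P s) := H.
have {}H : nbhs t (fun s => (s \in `]0, T[) /\ (s != t -> s \in `[0, T] -> P s)).
  exact: filterI (near_in_itvoo tT) H.
have [e /= e0 He] := (nbhs_ballP _ _).1 H.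
change (nbhs (0 : R) (fun h => h != 0 -> h + t \in `[0, T] /\ P (h + t))).
apply/nbhs_ballP; exists e => // h /= he h0.
have [|sT Ps] := He (h + t).
  by move: he; rewrite /ball/= sub0r normrN opprD addrCA subrr addr0 normrN.
have sT' : h + t \in `[0, T] by exact: subset_itv_oo_cc.
by split => //; apply: Ps => //; rewrite -subr_eq0 addrK.
Qed.

(** The mean of the field on the crest at time [t], and its total derivative, from the operator
    [∂_t + c ∂_k]. *)
Let B c t := slice_mean k (p t) (c * t).
Let B' c t := slice_mean k (q t) (c * t) + c * slice_mean k (pd [:: k] (p t)) (c * t).

(** A chain rule obtained by splitting the difference quotient: [F] moves the slice with the field
    frozen at time [t], while [E] is the increment of the field, read on the slice already moved.
    The uniform quotient brings [E] close to a mean of [q t], which is continuous in the slice. *)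
Lemma is_derive_slice_mean c t : t \in `]0, T[ -> is_derive t (1 : R) (B c) (B' c t).
Proof.
move=> tT; have tcT : t \in `[0, T] by exact: subset_itv_oo_cc.
have spt := scalar_test_smooth pq tcT; have sqt := scalar_test_smooth' pq tcT.
pose F s := slice_mean k (p t) (c * s).
have dF : is_derive t (1 : R) F (c * slice_mean k (pd [:: k] (p t)) (c * t)).
  exact: (C1_deriv_comp_scale c (C1_slice_mean k spt.1 spt.2)).1.
have F_cvg : h^-1 *: ((F \o shift t) (h *: (1 : R)) - F t) @[h --> 0^'] -->
    c * slice_mean k (pd [:: k] (p t)) (c * t).
  by case: dF => /cvgP + <-; move=> H; exact: (ex_derive (f := F)).
pose E h := h^-1 * (slice_mean k (p (h + t)) (c * (h + t)) - slice_mean k (p t) (c * (h + t))).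
have qc : continuous (fun s => slice_mean k (q t) (c * s)).
  by have := C1_deriv_continuous (C1_deriv_comp_scale c (C1_slice_mean k sqt.1 sqt.2)).
have E_cvg : E h @[h --> 0^'] --> slice_mean k (q t) (c * t).
  apply/cvgrPdist_le => e e0; have e2 : 0 < e / 2 by rewrite divr_gt0.
  have Q := near_shift tT (scalar_test_quotient pq tcT [::] e2).
  have A : \forall h \near 0^',
      `|slice_mean k (q t) (c * t) - slice_mean k (q t) (c * (h + t))| <= e / 2.
    rewrite /dnbhs; apply: near_within.
    have : slice_mean k (q t) (c * (h + t)) @[h --> 0] --> slice_mean k (q t) (c * (0 + t)).
      apply: (@continuous_comp _ _ _ (fun h => h + t) (fun s => slice_mean k (q t) (c * s))).
        by apply: cvgD; [exact: cvg_id|exact: cvg_cst].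
      exact: qc.
    by rewrite add0r => /cvgrPdist_le; apply.
  apply: filterS2 A Q => h Ah [hT Qh].
  rewrite [e]splitr -(subrKA (slice_mean k (q t) (c * (h + t)))) (le_trans (ler_normD _ _))//.
  apply: lerD => //.
  have bh := smooth_periodic_bm (scalar_test_smooth pq hT).
  have bt := smooth_periodic_bm spt.
  have -> : E h = slice_mean k (fun x => h^-1 * (p (h + t) x - p t x)) (c * (h + t)).
    rewrite /E /slice_mean -torus_intB; [|exact: bm_upd..].
    by rewrite -torus_intZ//; apply: bmB; exact: bm_upd.
  rewrite distrC; apply: slice_mean_sub_le.
  - by apply: bmM; [exact: bm_cst|exact: bmB].
  - exact: smooth_periodic_bm.
  - by move=> x; have := Qh x; rewrite addrK => /ltW.
have C : h^-1 *: ((B c \o shift t) (h *: (1 : R)) - B c t) @[h --> 0^'] --> B' c t.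
  rewrite (_ : (fun h => _) = fun h => E h + h^-1 *: ((F \o shift t) (h *: (1 : R)) - F t)).
    exact: cvgD.
  apply/funext => h; rewrite /E /F /B /= [h *: 1]mulr1.
  by rewrite -[_ *: _]/(_ * _) -[_ *: _]/(_ * _) -mulrDr addrA subrK.
by split; [apply/cvg_ex; eexists; exact: C|exact: cvg_lim C].
Qed.

(** The test field vanishes at [T], so only the initial value survives. The derivative is known at
    interior times only, hence the separate continuity of [B] up to the endpoints. *)
Lemma integral_slice_mean_derivative c : 0 < T ->
  \int[mu]_(t in `[0, T]) B' c t = - slice_mean k (p 0) 0.
Proof.
move=> T0.
have cB : {within `[0, T], continuous (B c)}.
  apply: slice_mean_time_continuous; first exact: scalar_test_smooth pq.
  exact: (scalar_test_unif_continuous [::]).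
have cB' : {within `[0, T], continuous (B' c)}.
  have c1 : {within `[0, T], continuous (fun t => slice_mean k (q t) (c * t))}.
    apply: slice_mean_time_continuous; first exact: scalar_test_smooth' pq.
    exact: (scalar_test_continuous pq [::]).
  have c2 : {within `[0, T], continuous (fun t => slice_mean k (pd [:: k] (p t)) (c * t))}.
    apply: slice_mean_time_continuous.
      by move=> t tT; apply: smooth_periodic_pd; exact: scalar_test_smooth pq _ tT.
    exact: (scalar_test_unif_continuous [:: k]).
  by move=> t; apply: cvgD; [exact: c1|apply: cvgM; [exact: cvg_cst|exact: c2]].
rewrite /Rintegral (@continuous_FTC2 _ (B' c) (B c) 0 T)//.
- rewrite /= /B mulr0 /slice_mean (eq_torus_int (g := fun=> 0)); last first.
    by move=> x; exact: scalar_test_final pq _.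
  by rewrite torus_int_cst sub0r.
- have /continuous_within_itvP[] := cB => //.
  move=> _ cl cr; split => // t tT.
  exact: (@ex_derive _ _ _ _ _ _ _ (is_derive_slice_mean c tT)).
- move=> t tT; rewrite derive1E.
  exact: (@derive_val _ _ _ _ _ _ _ (is_derive_slice_mean c tT)).
Qed.

End ScalarTest.
End Time.

(** * The traveling wave *)

Section Wave.
Context {R : realType}.
Local Notation mu := (@lebesgue_measure R).
Local Notation RT := (measurableTypeR R).
Variables (d : nat) (m : 'I_d) (M c : R).

Definition wave t (x : 'rV[R]_d) := M * profile (fpart (x 0 m - c * t)).
(** The classical derivative of [wave] in the [m]-th coordinate off the crest; on the crest [fpart]
    is 0, which selects the right-hand value when [M] is nonzero. *)
Definition wave' t (x : 'rV[R]_d) := M * profile' (fpart (x 0 m - c * t)).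

Let C1_Mprofile := C1_derivZ M (@C1_profile R).
Let C1_Mprofile' := C1_derivZ M (@C1_profile' R).

Lemma wave_bm t : bounded_measurable (wave t).
Proof. exact: (fpart_wave_bm m (c * t) (C1_deriv_continuous C1_Mprofile)). Qed.

Lemma wave'_bm t : bounded_measurable (wave' t).
Proof. exact: (fpart_wave_bm m (c * t) (C1_deriv_continuous C1_Mprofile')). Qed.

Lemma fpart1 (z : R) : fpart (z + 1) = fpart z.
Proof.
apply: (@fpart_def _ _ _ (Num.floor z + 1)); first by rewrite fpart_ge0 fpart_lt1.
by rewrite intrD /fpart addrA subrK.
Qed.

Lemma fpart_coord_periodic (s : R) : lattice_periodic (fun x : 'rV[R]_d => fpart (x 0 m - s)).
Proof.
move=> x j; rewrite !mxE /=.
by case: eqVneq => _; rewrite ?addr0// addrAC fpart1.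
Qed.

Definition wave_grad_fun t (x : 'rV[R]_d) : 'M[R]_d :=
  \matrix_(i, j) (if j == m then wave' t x else 0).

Lemma wave_grad_periodic t : lattice_periodic (wave_grad_fun t).
Proof.
by move=> x k; apply/matrixP => i j; rewrite !mxE /wave' fpart_coord_periodic.
Qed.

Definition wave_grad t := TorusMap (@wave_grad_periodic t).

Lemma wave_invariant (k : 'I_d) (x : 'rV[R]_d) (y : R) : k != m -> upd x k y 0 m = x 0 m.
Proof. by move=> km; rewrite mxE eq_sym (negbTE km). Qed.

Lemma bm_L2_torus (f : 'rV[R]_d -> R) : bounded_measurable f -> L2_torus f.
Proof.
move=> bf; split; first exact: bf.1.
under eq_integral do rewrite expr2.
have H := integrable_lty measurableT (bm_integrable (bmM bf bf)).
exact H.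
Qed.

(** Φ has a corner but no jump, since [profile 0 = profile 1]; hence the classical gradient is also
    the weak one. *)
Lemma wave_H1 t (v : torus_map d 'rV[R]_d) : (forall x i, v x 0 i = wave t x) ->
  H1_grad v (wave_grad t).
Proof.
move=> vE; split.
- by move=> i; apply: bm_L2_torus; under eq_fun do rewrite vE; exact: wave_bm.
- move=> i k; apply: bm_L2_torus; under eq_fun do rewrite mxE.
  by case: (k == m); [exact: wave'_bm|exact: bm_cst].
- move=> psi i k spsi; have ppsi : lattice_periodic psi by move=> x j; rewrite torus_funP.
  have bd := pd_bm [:: k] spsi ppsi; have bpsi := smooth_bm spsi ppsi.
  under eq_torus_int do rewrite vE.
  under [in RHS]eq_torus_int do rewrite mxE.
  have [->|km] := eqVneq k m.
    apply/eqP; rewrite -subr_eq0 opprK.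
    rewrite -torus_intD; [|by apply: bmM; [exact: wave_bm|exact: (pd_bm [:: m])]
      |by apply: bmM => //; exact: wave'_bm].
    rewrite (torus_int_fpart_jump m (c * t) C1_Mprofile)//.
    by rewrite profile1 profile0 subrr mul0r.
  rewrite (eq_torus_int (f := fun x => 0 * psi x) (g := fun=> 0)); last first.
    by move=> x; rewrite mul0r.
  rewrite torus_int_cst oppr0; apply: (torus_int_pd_invariant (b := wave t)) => //.
    exact: wave_bm.
  by move=> x y; rewrite /wave wave_invariant.
Qed.

(** Stated for arbitrary values [a] and [b] so as to serve for [u], for the difference of [u] at two
    times, and for the trace part of the stress. *)
Lemma H1_density (v : 'rV[R]_d) (a b : R) (P : 'M[R]_d) :
  (forall i, v 0 i = a) -> (forall i j, P i j = if j == m then b else 0) ->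
  dotv v v + ddot P P = d%:R * (a ^+ 2 + b ^+ 2).
Proof.
move=> va Pb; rewrite /dotv /ddot mulrDr; congr (_ + _).
  under eq_bigr do rewrite va.
  by rewrite sumr_const card_ord mulr_natl expr2.
under eq_bigr => i _.
  rewrite (bigD1 m)//= Pb eqxx big1 ?addr0 => [|j jm]; last by rewrite Pb (negbTE jm) mul0r.
  over.
by rewrite sumr_const card_ord mulr_natl expr2.
Qed.

Lemma fpart_near (z : R) : fpart z != 0 ->
  \forall z' \near z, fpart z' = z' - (Num.floor z)%:~R.
Proof.
move=> z0; have zI : z \in `](Num.floor z)%:~R, (Num.floor z + 1)%:~R[.
  rewrite in_itv/= floorD1_gt andbT lt_def ge_floor andbT.
  by rewrite -subr_eq0.
have := near_in_itvoo zI; apply: filterS => z'; rewrite in_itv/= intrD => /andP[a b].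
by apply: (@fpart_def _ _ _ (Num.floor z)); [apply/andP; split; lra|rewrite subrK].
Qed.

Lemma fpart_comp_continuous_at (g : R -> R) (z : R) : continuous g -> fpart z != 0 ->
  {for z, continuous (fun z => g (fpart z))}.
Proof.
move=> cg z0; have fz := fpart_near z0.
have : g (z' - (Num.floor z)%:~R) @[z' --> z] --> g (z - (Num.floor z)%:~R).
  have H : z' - (Num.floor z)%:~R @[z' --> z] --> z - (Num.floor z)%:~R.
    by apply: cvgB; [exact: cvg_id|exact: cvg_cst].
  exact: (cvg_comp _ _ H (cg _)).
by apply: cvg_trans; apply: near_eq_cvg; apply: filterS fz => z' ->.
Qed.

Lemma fpart_zero_null s : mu.-negligible [set y | fpart (y - s) = 0].
Proof.
have cA : countable [set y : R | fpart (y - s) = 0].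
  apply: (@sub_countable _ _ _ (range (fun n : int => n%:~R + s))).
    apply: subset_card_le => y /= /eqP; rewrite subr_eq0 => /eqP H.
    by exists (Num.floor (y - s)) => //; rewrite -H subrK.
  exact: sub_countable (card_image_le _ _) (countableP _).
apply/negligibleP; last exact: countable_lebesgue_measure0.
exact: countable_measurable.
Qed.

(** Continuity of translations in L^2 for a wave that may jump: convergence holds pointwise off the
    null set of crest points, and boundedness gives domination. *)
Lemma fpart_translation_cvg (g : R -> R) (s_ : R ^nat) (s : R) : continuous g ->
  s_ n @[n --> \oo] --> s ->
  (\int[mu]_(y in `[0, 1]) ((g (fpart (y - s_ n)) - g (fpart (y - s))) ^+ 2))
    @[n --> \oo] --> 0.
Proof.
move=> cg s_s; have [K gK] := fpart_bounded cg.
pose f_ n (y : RT) := ((g (fpart (y - s_ n)) - g (fpart (y - s))) ^+ 2)%:E.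
have m01 : measurable (`[0, 1]%classic : set RT) by [].
have [|||||_ _] := @dominated_convergence _ _ R mu `[0, 1] m01 f_ (cst 0%E)
  (cst ((K + K) ^+ 2)%:E).
- move=> n; apply/measurable_EFinP; apply: measurable_funTS; apply: measurable_funX.
  by apply: measurable_funB; exact: fpart_comp_measurable.
- exact: measurable_cst.
- have := fpart_zero_null s; rewrite /ae_filter_ringOfSetsType.
  apply: negligibleS => y /= H; apply: contrapT => /eqP ys; apply: H => _.
  apply: cvg_EFin; first exact: nearW.
  have H1 : g (fpart (y - s_ n)) @[n --> \oo] --> g (fpart (y - s)).
    have H0 : (y : R) - s_ n @[n --> \oo] --> (y : R) - s.
      by apply: cvgB; [exact: cvg_cst|exact: s_s].
    exact: (cvg_comp _ _ H0 (fpart_comp_continuous_at cg ys)).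
  have H2 : g (fpart (y - s_ n)) - g (fpart (y - s)) @[n --> \oo] --> (0 : R).
    rewrite -(subrr (g (fpart (y - s)))).
    by apply: cvgB; [exact: H1|exact: cvg_cst].
  have := cvgM H2 H2; rewrite mulr0.
  by move=> /(_ _); apply: cvg_trans.
- apply: (continuous_compact_integrable (f := cst ((K + K) ^+ 2))).
    exact: segment_compact.
  by apply: continuous_subspaceT => y; exact: cvg_cst.
- apply: aeW => y n _; rewrite /f_ gee0_abs ?lee_fin ?sqr_ge0//.
  rewrite -[_ ^+ 2]ger0_norm ?sqr_ge0// normrX lerXn2r ?nnegrE//.
    by rewrite addr_ge0// (le_trans _ (gK 0)).
  by rewrite (le_trans (ler_normB _ _))// lerD.
rewrite integral_cst// mul0e => H.
exact: fine_cvg H.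
Qed.

Lemma torus_int_coord (h : R -> R) : bounded_measurable (fun x : 'rV[R]_d => h (x 0 m)) ->
  torus_int (fun x : 'rV[R]_d => h (x 0 m)) = \int[mu]_(y in `[0, 1]) h y.
Proof.
move=> bh; rewrite (torus_int_fubini m)// -[RHS](torus_int_cst d).
by apply: eq_torus_int => x; apply: eq_Rintegral => y _; rewrite updK.
Qed.

Lemma torus_int_translation_cvg (g : R -> R) (s_ : R ^nat) (s : R) : continuous g ->
  s_ n @[n --> \oo] --> s ->
  torus_int (fun x : 'rV[R]_d => (g (fpart (x 0 m - s_ n)) - g (fpart (x 0 m - s))) ^+ 2)
    @[n --> \oo] --> 0.
Proof.
move=> cg s_s.
have := fpart_translation_cvg cg s_s; apply: cvg_trans.
apply: near_eq_cvg; apply: nearW => n.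
rewrite (torus_int_coord (h := fun y => (g (fpart (y - s_ n)) - g (fpart (y - s))) ^+ 2))//.
under eq_fun do rewrite expr2.
by apply: bmM; apply: bmB; exact: fpart_wave_bm.
Qed.

Definition grid n (j : nat) : R := j%:R / n.+1%:R.
Definition grid_floor n (t : R) : nat := Num.truncn (t * n.+1%:R).

Lemma grid_floorP n t : 0 <= t ->
  grid n (grid_floor n t) <= t < grid n (grid_floor n t).+1.
Proof.
move=> t0; rewrite /grid ler_pdivrMr// ltr_pdivlMr//.
by apply: truncn_itv; rewrite mulr_ge0.
Qed.

Lemma grid_floor_cvg t : 0 <= t -> grid n (grid_floor n t) @[n --> \oo] --> t.
Proof.
move=> t0; apply/cvgrPdist_lt => e e0; near=> n.
have /andP[le_t t_lt] := grid_floorP n t0.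
rewrite ger0_norm ?subr_ge0//.
apply: (@le_lt_trans _ _ n.+1%:R^-1).
  have E k : grid n k.+1 = grid n k + n.+1%:R^-1 by rewrite /grid -[k.+1%:R]natr1 mulrDl mul1r.
  by rewrite lerBlDl -E ltW.
by near: n; exact: (near_infty_natSinv_lt (PosNum e0)).
Unshelve. all: end_near. Qed.

(** Sampling [u] on a time grid gives simple functions. At each time their H^1 error compares two
    translates of one wave, so it vanishes by continuity of translations in L^2, although [wave']
    does not converge uniformly near the crest in general. *)
Lemma wave_Linfty T (u : R -> torus_map d 'rV[R]_d) :
  (forall t x i, u t x 0 i = wave t x) -> Linfty_H1 T u wave_grad.
Proof.
move=> uE; have uH t := wave_H1 (uE t).
split; first by apply: aeW => t _.
(* Enough cells of length [1/(n+1)] to cover []0, T[], the last one making up for the rounding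
   down. *)
- pose N n := (Num.truncn (T * n.+1%:R)).+1.
  pose A n (j : 'I_(N n)) : set RT := `[grid n j, grid n j.+1[%classic.
  exists (fun n t x => \sum_(j < N n) \1_(A n j) t *: u (grid n j) x),
    (fun n t x => \sum_(j < N n) \1_(A n j) t *: wave_grad (grid n j) x); split.
    move=> n; exists (N n), (A n), (fun j => u (grid n j)), (fun j => wave_grad (grid n j)).
    split => //.
    by move=> j; exact: measurable_itv.
  apply: aeW => t; rewrite in_itv/= => /andP[t0 tT].
  pose J n := grid_floor n t.
  have JN n : (J n < N n)%N.
    by rewrite ltnS; apply: le_truncn; rewrite ler_pM2r// ltW.
  have AE n (j : 'I_(N n)) : \1_(A n j) t = (j == Ordinal (JN n))%:R :> R.
    rewrite indicE; congr ((nat_of_bool _)%:R); apply/idP/idP.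
      rewrite inE /A/= in_itv/= /grid ler_pdivrMr// ltr_pdivlMr// => H.
      by apply/eqP/val_inj; rewrite /= /J /grid_floor (truncn_def H).
    move=> /eqP ->; rewrite inE /A/= in_itv/=.
    exact: grid_floorP (ltW t0).
  have sumE n (V : lmodType R) (f : nat -> V) :
      \sum_(j < N n) \1_(A n j) t *: f j = f (J n).
    rewrite (bigD1 (Ordinal (JN n)))//= AE eqxx scale1r big1 ?addr0// => j jn.
    by rewrite AE (negbTE jn) scale0r.
  pose D1 n := torus_int (fun x => (wave (grid n (J n)) x - wave t x) ^+ 2).
  pose D2 n := torus_int (fun x => (wave' (grid n (J n)) x - wave' t x) ^+ 2).
  (* The half-open cells are disjoint, so a single sample survives at time [t]. The factor [d]
     counts the equal components. *)
  have -> : (fun n => H1_norm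
        (fun x => \sum_(j < N n) \1_(A n j) t *: u (grid n j) x - u t x)
        (fun x => \sum_(j < N n) \1_(A n j) t *: wave_grad (grid n j) x - wave_grad t x))
      = fun n => Num.sqrt (d%:R * (D1 n + D2 n)).
    apply/funext => n; rewrite /H1_norm /D1 /D2; congr Num.sqrt.
    have b1 : bounded_measurable (fun x => (wave (grid n (J n)) x - wave t x) ^+ 2).
      under eq_fun do rewrite expr2.
      by apply: bmM; apply: bmB; exact: wave_bm.
    have b2 : bounded_measurable (fun x => (wave' (grid n (J n)) x - wave' t x) ^+ 2).
      under eq_fun do rewrite expr2.
      by apply: bmM; apply: bmB; exact: wave'_bm.
    rewrite -torus_intD// -torus_intZ; last exact: bmD.
    apply: eq_torus_int => x.
    apply: H1_density => [i|i j].
      by rewrite (sumE _ _ (fun j => u (grid n j) x)) !mxE !uE.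
    rewrite (sumE _ _ (fun j => wave_grad (grid n j) x)) !mxE.
    by case: (j == m); rewrite ?subrr.
  have cs : c * grid n (J n) @[n --> \oo] --> c * t.
    by apply: cvgM; [exact: cvg_cst|exact: grid_floor_cvg (ltW t0)].
  have D1_0 : D1 n @[n --> \oo] --> 0.
    exact: (torus_int_translation_cvg (C1_deriv_continuous C1_Mprofile) cs).
  have D2_0 : D2 n @[n --> \oo] --> 0.
    exact: (torus_int_translation_cvg (C1_deriv_continuous C1_Mprofile') cs).
  have H : d%:R * (D1 n + D2 n) @[n --> \oo] --> (0 : R).
    rewrite -(mulr0 (d%:R : R)) -[X in _ * X](addr0 0).
    by apply: cvgM; [exact: cvg_cst|exact: cvgD].
  have := cvg_comp _ _ H (@sqrt_continuous R 0).
  by rewrite sqrtr0.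
- have [K1 wK] := fpart_bounded (C1_deriv_continuous C1_Mprofile).
  have [K2 w'K] := fpart_bounded (C1_deriv_continuous C1_Mprofile').
  exists (Num.sqrt (d%:R * (K1 ^+ 2 + K2 ^+ 2))); apply: aeW => t _.
  rewrite /H1_norm ler_wsqrtr//.
  rewrite (eq_torus_int (g := fun x => d%:R * (wave t x ^+ 2 + wave' t x ^+ 2))); last first.
    by move=> x; apply: H1_density => [i|i j]; rewrite ?uE// mxE.
  rewrite -[leRHS](torus_int_cst d); apply: le_torus_int; last 1 first.
  + have sqr_le (y K : R) : `|y| <= K -> y ^+ 2 <= K ^+ 2.
      by move=> yK; rewrite -[y ^+ 2]real_normK ?num_real// lerXn2r// nnegrE (le_trans _ yK).
    by move=> x; rewrite ler_wpM2l// lerD//; apply: sqr_le; [exact: wK|exact: w'K].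
  + apply: bmM; first exact: bm_cst.
    under eq_fun do rewrite !expr2.
    by apply: bmD; apply: bmM; (exact: wave_bm || exact: wave'_bm).
  + exact: bm_cst.
Qed.
End Wave.

(** * Lipschitz bound for periodic functions without jump *)

Section Lipschitz.
Context {R : realType}.

Lemma fpart_comp_lipschitz (g g' : R -> R) : C1_deriv g g' -> g 0 = g 1 ->
  exists2 L, 0 <= L & forall y z, `|g (fpart y) - g (fpart z)| <= L * `|y - z|.
Proof.
move=> Cg g01.
(* The intermediate point lies within distance 1 of a point of [[0, 1]], hence in [[-1, 2]]. *)
have /compact_bounded[K [_ gK]] : compact (g' @` `[-1, 2]).
  apply: continuous_compact; last exact: segment_compact.
  exact: continuous_subspaceT Cg.2.
have {}gK y : y \in `[-1, 2] -> `|g' y| <= `|K| + 1.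
  by move=> yI; apply: gK; [rewrite ltr_pwDr// ler_norm|exists y].
have L0 : 0 <= `|K| + 1 by rewrite addr_ge0.
have lip a b : 0 <= a <= 1 -> 0 <= b <= 1 -> `|g b - g a| <= (`|K| + 1) * `|b - a|.
  move=> a01 b01; have [e ea ->] := C1_deriv_MVT a b Cg.
  rewrite normrM ler_wpM2r// gK// in_itv/=.
  have : `|b - a| <= 1 by rewrite ler_norml; apply/andP; split; lra.
  by move=> /(le_trans ea); rewrite ler_norml => /andP[? ?]; apply/andP; split; lra.
exists (`|K| + 1) => // y z.
wlog yz : y z / y <= z.
  move=> H; have [yz|/ltW zy] := leP y z; first exact: H.
  by rewrite distrC [`|y - z|]distrC; exact: H.
have [y01 z01] := (fpart_itv y, fpart_itv z); rewrite !in_itv/= in y01 z01.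
have yE : y = fpart y + (Num.floor y)%:~R by rewrite /fpart subrK.
have zE : z = fpart z + (Num.floor z)%:~R by rewrite /fpart subrK.
have := le_floor yz; rewrite le_eqVlt => /predU1P[fE|].
  have -> : y - z = fpart y - fpart z by rewrite {1}yE {1}zE fE; ring.
  exact: lip.
(* When an integer separates [y] from [z], the comparison passes through the common value
   [g 1 = g 0]; the distances from [fpart y] up to 1 and from 0 to [fpart z] add up to at most
   [|y - z|]. *)
rewrite -lezD1 -(ler_int R) intrD => fE.
rewrite -(subrKA (g 1)) (le_trans (ler_normD _ _))// -{2}g01.
rewrite [`|y - z|]distrC [`|z - y|]ger0_norm ?subr_ge0//.
have := lip 1 (fpart y); have := lip (fpart z) 0; rewrite !lexx !ler01 => lz ly.
have {}ly := ly isT y01; have {}lz := lz z01 isT.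
apply: (le_trans (lerD ly lz)).
rewrite -mulrDr ler_wpM2l// sub0r normrN distrC.
by rewrite ger0_norm ?subr_ge0 ?(andP y01).2// ger0_norm ?(andP z01).1//; lra.
Qed.

End Lipschitz.

(** * The spatial integrals of the weak identity *)

Section WeakIdentity.
Context {R : realType}.
Local Notation mu := (@lebesgue_measure R).
Variables (d : nat) (m : 'I_d) (M c T : R).
Local Notation wave := (wave m M c).
Local Notation wave' := (wave' m M c).
Local Notation wave_grad := (wave_grad m M c).

(** Off the crest this is the derivative of [wave * wave'], which is why the stress and the cubic
    term share it. *)
Definition energy t x := wave t x * wave t x + wave' t x * wave' t x.

Lemma energy_bm t : bounded_measurable (energy t).
Proof. by apply: bmD; apply: bmM; (exact: wave_bm || exact: wave'_bm). Qed.

Let C1_w := C1_derivZ M (@C1_profile R).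
Let C1_w' := C1_derivZ M (@C1_profile' R).

Lemma continuous_torus_int_energy (F : R -> 'rV[R]_d -> R) :
  (forall t, t \in `[0, T] -> smooth_periodic (F t)) -> unif_continuous_in_time T F ->
  {within `[0, T], continuous (fun t => torus_int (fun x => energy t x * F t x))}.
Proof.
move=> sF uF; apply/subspace_continuousP => t tT.
have CE := C1_derivD (C1_derivM C1_w C1_w) (C1_derivM C1_w' C1_w').
(* The end values agree because [profile'] is -1 at 0 and 1 at 1, with equal squares. *)
have [|L L0 EL] := fpart_comp_lipschitz CE.
  by rewrite profile0 profile1 profile'0 profile'1; ring.
have [K EK] := fpart_bounded (C1_deriv_continuous CE).
have K0 : 0 <= K by exact: le_trans (EK 0).
have bt := smooth_periodic_bm (sF _ tT); have [_ [N FN]] := bt.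
have N0 : 0 <= N by exact: le_trans (FN 0).
apply/cvgrPdist_le => e e0; have e2 : 0 < e / 2 by rewrite divr_gt0.
have ct : \forall s \near within [set` `[0, T]] (nbhs t), L * `|c * (t - s)| * N <= e / 2.
  apply: near_within.
  have : L * `|c * (t - s)| * N @[s --> t] --> L * `|c * (t - t)| * N.
    apply: cvgM; last exact: cvg_cst.
    apply: cvgM; first exact: cvg_cst.
    apply: cvg_norm; apply: cvgM; first exact: cvg_cst.
    by apply: cvgB; [exact: cvg_cst|exact: cvg_id].
  rewrite subrr mulr0 normr0 mulr0 mul0r => /cvgrPdist_le /(_ _ e2).
  apply: filterS => s; rewrite sub0r normrN => /(le_trans _); apply; exact: ler_norm.
have eK : 0 < e / 2 / (K + 1) by rewrite divr_gt0// ltr_wpDl.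
have sT : \forall s \near within [set` `[0, T]] (nbhs t), s \in `[0, T] by exact: withinT.
apply: filterS3 ct (uF t tT _ eK) sT => s cs Fs {}sT.
have bs := smooth_periodic_bm (sF _ sT).
rewrite -torus_intB; [|by apply: bmM => //; exact: energy_bm..].
apply: torus_int_norm_le.
  by apply: bmB; apply: bmM => //; exact: energy_bm.
move=> x.
have -> : energy t x * F t x - energy s x * F s x =
   (energy t x - energy s x) * F t x - energy s x * (F s x - F t x) by ring.
rewrite [e]splitr (le_trans (ler_normB _ _))// lerD// normrM.
  apply: le_trans cs; apply: ler_pM => //.
  apply: le_trans (EL (x 0 m - c * t) (x 0 m - c * s)) _.
  have -> : x 0 m - c * t - (x 0 m - c * s) = - (c * (t - s)) by ring.
  by rewrite normrN.
have : `|energy s x| * `|F s x - F t x| <= K * (e / 2 / (K + 1)).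
  by apply: ler_pM => //; [exact: EK|exact: ltW].
move=> /le_trans; apply.
rewrite mulrA ler_pdivrMr ?ltr_wpDl// mulrC ler_wpM2l ?lerDl//.
exact: ltW.
Qed.

Variable u : R -> @torus_map R d 'rV[R]_d.
Hypothesis uE : forall t x i, u t x 0 i = wave t x.

Section Slice.
Variables (t : R) (v : @torus_map R d 'rV[R]_d).
Hypothesis sv : smooth_field v.
Local Notation v_ i := (fun x => v x 0 i).

Let spv i : smooth_periodic (v_ i).
Proof. by split; [exact: sv|move=> x k; rewrite torus_funP]. Qed.

Let bv i : bounded_measurable (v_ i). Proof. exact: smooth_periodic_bm. Qed.

Let bdv al i : bounded_measurable (pd al (v_ i)).
Proof. exact: smooth_periodic_bm (smooth_periodic_pd al (spv i)). Qed.

(** The weak form of [w - w'' = 2 M δ]: the momentum sits on the crest, with weight the jump of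
    [w'], from [-M] to [M]. *)
Lemma wave_pairing :
  torus_int (fun x => dotv (u t x) (v x) + ddot (wave_grad t x) (grad v x)) =
  \sum_i 2 * M * slice_mean m (v_ i) (c * t).
Proof.
transitivity (torus_int (fun x => \sum_i
    (wave' t x * pd [:: m] (v_ i) x + wave t x * v_ i x))).
  apply: eq_torus_int => x; rewrite /dotv /ddot -big_split; apply: eq_bigr => i _ /=.
  rewrite uE addrC; congr (_ + _).
  rewrite (bigD1 m)//= !mxE eqxx big1 ?addr0// => j jm.
  by rewrite !mxE (negbTE jm) mul0r.
rewrite torus_int_sum => [|i]; last first.
  by apply: bmD; apply: bmM => //; (exact: wave_bm || exact: wave'_bm || exact: bdv).
apply: eq_bigr => i _.
rewrite (torus_int_fpart_jump m (c * t) C1_w' (spv i).1 (spv i).2).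
by rewrite profile'1 profile'0; congr (_ * _); ring.
Qed.

(** As all components of [u] agree, the tensor square of [u] and [G G^T] have all entries equal to
    [w^2] and [w'^2]. In [G^T G] the [d] equal rows add up in the single entry [(m, m)]. *)
Lemma wave_stressE x i j : stress (u t x) (wave_grad t x) i j =
  energy t x
  - (if (i == m) && (j == m) then d%:R * (wave' t x * wave' t x) else 0)
  + (if i == j then 2^-1 * (d%:R * energy t x) else 0).
Proof.
rewrite /stress (H1_density (m := m) (a := wave t x) (b := wave' t x)); last 2 first.
- by move=> k; rewrite uE.
- by move=> k l; rewrite mxE.
have GGT : (wave_grad t x *m (wave_grad t x)^T) i j = wave' t x * wave' t x.
  rewrite mxE (bigD1 m)//= !mxE eqxx big1 ?addr0// => k km.
  by rewrite !mxE (negbTE km) mul0r.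
have GTG : ((wave_grad t x)^T *m wave_grad t x) i j =
    if (i == m) && (j == m) then d%:R * (wave' t x * wave' t x) else 0.
  rewrite mxE (eq_bigr (fun=> if (i == m) && (j == m) then wave' t x * wave' t x else 0)).
    by case: ifP => _; [rewrite sumr_const card_ord mulr_natl|rewrite big1].
  by move=> k _; rewrite !mxE; case: (i == m); case: (j == m); rewrite ?mul0r ?mulr0.
have vv : ((u t x)^T *m u t x) i j = wave t x * wave t x.
  by rewrite mxE big_ord1 mxE !uE.
rewrite [LHS]mxE [X in X + _]mxE [X in X + _ + _]mxE vv GGT.
rewrite [X in _ + X + _]mxE GTG [X in _ + _ + X]mxE -!expr2 -/(energy t x).
by case: (i == j); rewrite ?mulr1n ?mulr0n // /energy !expr2.
Qed.

Lemma energy_invariant k y x : k != m -> energy t (upd x k y) = energy t x.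
Proof. by move=> km; rewrite /energy /wave /wave' wave_invariant. Qed.

(** Columns other than [m] carry derivatives along the crest and integrate to 0. In column [m] the
    diagonal corrections meet only in the entry [(m, m)], where they sum to a constant. *)
Lemma wave_stress_pairing :
  torus_int (fun x => ddot (stress (u t x) (wave_grad t x)) (grad v x)) =
  \sum_i torus_int (fun x => energy t x * pd [:: m] (v_ i) x).
Proof.
have bE := energy_bm t.
pose b1 i j x := if (i == m) && (j == m) then d%:R * (wave' t x * wave' t x) else 0.
pose b2 (i j : 'I_d) x := if i == j then 2^-1 * (d%:R * energy t x) else 0.
have bb1 i j : bounded_measurable (b1 i j).
  rewrite /b1; case: ((i == m) && (j == m)); last exact: bm_cst.
  by apply: bmM; [exact: bm_cst|apply: bmM; exact: wave'_bm].
have bb2 i j : bounded_measurable (b2 i j).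
  rewrite /b2; case: (i == j); last exact: bm_cst.
  by apply: bmM; [exact: bm_cst|apply: bmM => //; exact: bm_cst].
pose f i j x := (energy t x - b1 i j x + b2 i j x) * pd [:: j] (v_ i) x.
have bf i j : bounded_measurable (f i j).
  by apply: bmM; [apply: bmD => //; exact: bmB|exact: bdv].
transitivity (torus_int (fun x => \sum_i \sum_j f i j x)).
  apply: eq_torus_int => x; rewrite /ddot; apply: eq_bigr => i _; apply: eq_bigr => j _.
  by rewrite wave_stressE mxE.
rewrite torus_int_sum => [|i]; last exact: bm_sum.
apply: eq_bigr => i _; rewrite torus_int_sum//.
rewrite (bigD1 m)//= [X in _ + X]big1 ?addr0; last first.
  move=> j jm; apply: torus_int_pd_invariant; [|move=> x y|exact: (spv i).1|exact: (spv i).2].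
    by apply: bmD => //; exact: bmB.
  by rewrite /b1 /b2 energy_invariant// (negbTE jm) andbF.
have [->|im] := eqVneq i m; last first.
  apply: eq_torus_int => x; rewrite /f /b1 /b2 (negbTE im).
  by rewrite subr0 addr0.
(* From [- d w'^2 + (d/2) (w^2 + w'^2) = (d/2) (w^2 - w'^2)], a constant whose product with a
   derivative integrates to 0. *)
pose K := d%:R / 2 * (M ^+ 2 * (sinh 2^-1 ^+ 2)^-1).
transitivity (torus_int (fun x => energy t x * pd [:: m] (v_ m) x + K * pd [:: m] (v_ m) x)).
  apply: eq_torus_int => x; rewrite /f /b1 /b2 eqxx/= -mulrDl; congr (_ * _).
  rewrite -addrA; congr (_ + _); rewrite /K -(profile_sqrB (fpart (x 0 m - c * t))).
  by rewrite /energy /wave /wave'; field.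
rewrite torus_intD; last 2 first.
- by apply: bmM => //; exact: bdv.
- by apply: bmM; [exact: bm_cst|exact: bdv].
rewrite (torus_int_pd_invariant (b := fun=> K) _ _ (spv m).1 (spv m).2) ?addr0//.
exact: bm_cst.
Qed.

(** The jump formula for [w w'], whose derivative off the crest is [energy]. Its jump is
    [2 M^2 Φ(0)], and the speed condition identifies it with [2 M c]. *)
Lemma wave_cubic_pairing i j k : c = M * profile 0 ->
  torus_int (fun x => u t x 0 j * wave_grad t x i k * pd [:: j; k] (v_ i) x) =
  if (j == m) && (k == m) then
    2 * M * c * slice_mean m (pd [:: m] (v_ i)) (c * t)
    - torus_int (fun x => energy t x * pd [:: m] (v_ i) x)
  else 0.
Proof.
move=> cE; have [->|km] := eqVneq k m; last first.
  rewrite andbF (eq_torus_int (g := fun=> 0)) ?torus_int_cst// => x.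
  by rewrite mxE (negbTE km) mulr0 mul0r.
have [s' p'] := smooth_periodic_pd [:: m] (spv i).
pose f := pd [:: m] (v_ i).
have bw : bounded_measurable (fun x => wave t x * wave' t x).
  by apply: bmM; [exact: wave_bm|exact: wave'_bm].
rewrite (eq_torus_int (g := fun x => wave t x * wave' t x * pd [:: j] f x)); last first.
  by move=> x; rewrite uE mxE eqxx.
have [->|jm] := eqVneq j m; last first.
  apply: torus_int_pd_invariant => // x y.
  by rewrite /wave /wave' wave_invariant.
have := torus_int_fpart_jump m (c * t) (C1_derivM C1_w C1_w') s' p'.
rewrite torus_intD; last 2 first.
- exact: bmM bw (bdv [:: m; m] i).
- exact: bmM (energy_bm t) (bdv [:: m] i).
rewrite /= => H; apply/eqP; rewrite -subr_eq opprK; apply/eqP.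
rewrite H profile'0 profile'1 profile1 -profile0 cE; congr (_ * _); ring.
Qed.
End Slice.
End WeakIdentity.

(** * Integration in time and summation over the components *)

Section Main.
Context {R : realType}.
Local Notation mu := (@lebesgue_measure R).

Lemma within_continuous_integrable (f : R -> R) a b :
  {within `[a, b], continuous f} -> mu.-integrable `[a, b] (EFin \o f).
Proof. by apply: continuous_compact_integrable; exact: segment_compact. Qed.

Lemma Rintegral_sum_continuous (I : Type) (r : seq I) (f : I -> R -> R) a b :
  (forall i, {within `[a, b], continuous (f i)}) ->
  \int[mu]_(t in `[a, b]) (\sum_(i <- r) f i t) = \sum_(i <- r) \int[mu]_(t in `[a, b]) f i t.
Proof.
move=> cf.
have csum s : {within `[a, b], continuous (fun t => \sum_(i <- s) f i t)}.
  elim: s => [|i s IH].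
    rewrite (_ : (fun t => _) = fun=> 0); last by apply/funext => t; rewrite big_nil.
    by move=> t; exact: cvg_cst.
  rewrite (_ : (fun t => _) = fun t => f i t + \sum_(i <- s) f i t); last first.
    by apply/funext => t; rewrite big_cons.
  by move=> t; apply: cvgD; [exact: cf|exact: IH].
elim: r => [|i r IH].
  rewrite big_nil; under eq_Rintegral => t _ do rewrite big_nil.
  by rewrite Rintegral_cst// mul0r.
rewrite big_cons -IH; under eq_Rintegral => t _ do rewrite big_cons.
by rewrite RintegralD//; exact: within_continuous_integrable.
Qed.

Variables (d : nat) (m : 'I_d) (M c : R).
Hypothesis cE : c = M * profile 0.

Lemma wave_weak_solution (T : R) (u : R -> @torus_map R d 'rV[R]_d) : 0 < T ->
  (forall t x i, u t x 0 i = wave m M c t x) -> weak_solution T (u 0) u.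
Proof.
move=> T0 uE; exists (wave_grad m M c 0), (wave_grad m M c); split.
- exact: wave_H1.
- exact: wave_Linfty.
move=> phi phit tf; have sc i := test_field_scalar i tf.
have [smooth_tf _ _ _] := tf.
pose P i t x := phi t x 0 i; pose Q i t x := phit t x 0 i.
have zT : 0 \in `[0, T] by rewrite in_itv/= lexx ltW.
(* [A] comes from the time derivative of the test field, [D] from the motion of the crest, and [S]
   is the energy integral, with sign plus in the stress and minus in the cubic term. *)
pose A i t := 2 * M * slice_mean m (Q i t) (c * t).
pose D i t := 2 * M * (c * slice_mean m (pd [:: m] (P i t)) (c * t)).
pose S i t := torus_int (fun x => energy m M c t x * pd [:: m] (P i t) x).
have cQ i : {within `[0, T], continuous (fun t => slice_mean m (Q i t) (c * t))}.
  exact: slice_mean_time_continuous (scalar_test_smooth' (sc i))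
    (scalar_test_continuous (sc i) [::]).
have cA i : {within `[0, T], continuous (A i)}.
  by move=> t; apply: cvgM; [exact: cvg_cst|exact: cQ].
have sP1 i t : t \in `[0, T] -> smooth_periodic (pd [:: m] (P i t)).
  by move=> tT; apply: smooth_periodic_pd; exact: scalar_test_smooth (sc i) _ tT.
have uP1 i := scalar_test_unif_continuous (sc i) [:: m].
have cP i : {within `[0, T],
    continuous (fun t => c * slice_mean m (pd [:: m] (P i t)) (c * t))}.
  have H := slice_mean_time_continuous (k := m) (c := c) (sP1 i) (uP1 i).
  by move=> t; apply: cvgM; [exact: cvg_cst|exact: H].
have cD i : {within `[0, T], continuous (D i)}.
  by move=> t; apply: cvgM; [exact: cvg_cst|exact: cP].
have cS i : {within `[0, T], continuous (S i)}.
  exact: continuous_torus_int_energy (sP1 i) (uP1 i).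
have I1 : \int[mu]_(t in `[0, T]) torus_int (fun x => dotv (u t x) (phit t x)
    + ddot (wave_grad m M c t x) (grad (phit t) x)) = \sum_i \int[mu]_(t in `[0, T]) A i t.
  rewrite -Rintegral_sum_continuous//; apply: eq_Rintegral => t; rewrite inE => tT.
  exact: wave_pairing (smooth_tf t tT).2.
have I2 : torus_int (fun x => dotv (u 0 x) (phi 0 x)
    + ddot (wave_grad m M c 0 x) (grad (phi 0) x)) = \sum_i 2 * M * slice_mean m (P i 0) 0.
  rewrite (wave_pairing uE 0 (smooth_tf 0 zT).1).
  by apply: eq_bigr => i _; rewrite mulr0.
have I3 : \int[mu]_(t in `[0, T]) torus_int (fun x =>
    ddot (stress (u t x) (wave_grad m M c t x)) (grad (phi t) x)) =
    \sum_i \int[mu]_(t in `[0, T]) S i t.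
  rewrite -Rintegral_sum_continuous//; apply: eq_Rintegral => t; rewrite inE => tT.
  exact: wave_stress_pairing (smooth_tf t tT).1.
have I4 i : \sum_j \sum_k \int[mu]_(t in `[0, T]) torus_int (fun x =>
    u t x 0 j * wave_grad m M c t x i k * pd [:: j; k] (fun y => phi t y 0 i) x) =
    \int[mu]_(t in `[0, T]) (D i t - S i t).
  have L j k : \int[mu]_(t in `[0, T]) torus_int (fun x =>
      u t x 0 j * wave_grad m M c t x i k * pd [:: j; k] (fun y => phi t y 0 i) x) =
      if (j == m) && (k == m) then \int[mu]_(t in `[0, T]) (D i t - S i t) else 0.
    transitivity (\int[mu]_(t in `[0, T])
        (if (j == m) && (k == m) then D i t - S i t else 0)).
      apply: eq_Rintegral => t; rewrite inE => tT.
      by rewrite (wave_cubic_pairing uE t (smooth_tf t tT).1 i j k cE) /D !mulrA.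
    by case: ifP => _ //; rewrite Rintegral_cst// mul0r.
  rewrite (bigD1 m)//= [X in _ + X]big1 ?addr0; last first.
    by move=> j jm; rewrite big1// => k _; rewrite L (negbTE jm).
  rewrite (bigD1 m)//= [X in _ + X]big1 ?addr0; last first.
    by move=> k km; rewrite L (negbTE km) andbF.
  by rewrite L eqxx.
(* The identity holds for each component separately: [S] cancels, and [A + D] is [2 M] times the
   total derivative along the crest, whose integral offsets the initial term. *)
rewrite I1 I2 I3 -!big_split/=; apply: big1 => i _.
rewrite I4 RintegralB//; [|exact: within_continuous_integrable..].
have := integral_slice_mean_derivative m (sc i) c T0.
rewrite -[- _]mulN1r => /(congr1 ( *%R (2 * M))).
rewrite -RintegralZl//; last first.
  by apply: within_continuous_integrable => t; apply: cvgD; [exact: cQ|exact: cP].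
have -> : \int[mu]_(t in `[0, T]) (2 * M * (slice_mean m (Q i t) (c * t) +
   c * slice_mean m (pd [:: m] (P i t)) (c * t))) = \int[mu]_(t in `[0, T]) (A i t + D i t).
  by apply: eq_Rintegral => t _; rewrite mulrDr.
rewrite RintegralD//; [|exact: within_continuous_integrable..].
rewrite -/(P i).
move: (Rintegral _ _ _) (Rintegral _ _ _) (Rintegral _ _ _) (slice_mean _ _ _).
by move=> IA ID IS p0 H; rewrite mulN1r mulrN in H; rewrite addrA addrAC addrK addrAC H addNr.
Qed.

End Main.

(** * The direction vector *)

Section Reduction.
Context {R : realType}.

(** A nonzero integer entry has square at least 1 and so exhausts the squared norm. *)
Lemma integral_unit_vector d (a : 'rV[R]_d) :
  enorm a = 1 -> (forall k, fpart (a 0 k) = 0) ->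
  exists2 m, (a 0 m = 1 \/ a 0 m = -1) & forall j, j != m -> a 0 j = 0.
Proof.
move=> a1 aZ.
have aa0 : 0 <= dotv a a by apply: sumr_ge0 => i _; rewrite -expr2 sqr_ge0.
have aa1 : dotv a a = 1 by rewrite -(sqr_sqrtr aa0) -/(enorm a) a1 expr1n.
have [m am|H] := pickP (fun m => a 0 m != 0); last first.
  move: aa1; rewrite /dotv big1 => [/eqP|i _]; first by rewrite eq_sym oner_eq0.
  by have := H i => /negbFE/eqP ->; rewrite mul0r.
have aint k : a 0 k = (Num.floor (a 0 k))%:~R.
  by apply/eqP; rewrite -subr_eq0 -/(fpart _) aZ.
have am1 : 1 <= a 0 m * a 0 m.
  rewrite aint -intrM -[1]/(1%:~R) ler_int -expr2 -gtz0_ge1 lt_def sqr_ge0 andbT sqrf_eq0.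
  by apply: contra_neq am => f0; rewrite aint f0.
have rest0 : 0 <= \sum_(j | j != m) a 0 j * a 0 j.
  by apply: sumr_ge0 => i _; rewrite -expr2 sqr_ge0.
move: aa1; rewrite /dotv (bigD1 m)//= => aa1.
have amE : a 0 m * a 0 m = 1 by lra.
exists m.
  have : (a 0 m - 1) * (a 0 m + 1) = 0 by rewrite mulrDr mulrBl amE; ring.
  by move/eqP; rewrite mulf_eq0 subr_eq0 addr_eq0 => /orP[] /eqP ->; [left|right].
move=> j jm.
have : \sum_(j | j != m) a 0 j * a 0 j = 0 by lra.
move=> /psumr_eq0P H; apply/eqP; rewrite -sqrf_eq0 expr2 H// => i _.
by rewrite -expr2 sqr_ge0.
Qed.
End Reduction.

Theorem mainTheorem4 (R : realType) (d : nat) (M C : R) (a : 'rV[R]_d)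
    (ha : enorm a = 1)
    (hC : C = cosh 2^-1 / sinh 2^-1 * M * \sum_j a 0 j)
    (u : R -> torus_map d 'rV[R]_d)
    (hu : forall t x i,
       u t x 0 i = M * peakon_profile (\sum_j a 0 j * x 0 j - C * t))
    (T : R) (hT : 0 < T) :
  weak_solution T (u 0) u.
Proof.
have [M0|M0] := eqVneq M 0.
  (* For [M = 0] nothing constrains [a], but [u] vanishes and is the wave of amplitude and speed 0
     in any direction; one exists since [|a| = 1] excludes [d = 0]. *)
  have [m|d0] := pickP (fun _ : 'I_d => true); last first.
    move: ha; rewrite /enorm /dotv big1 => [|i]; last by have := d0 i.
    by rewrite sqrtr0 => /eqP; rewrite eq_sym oner_eq0.
  move=> _; apply: (@wave_weak_solution R d m 0 0) => //; first by rewrite mul0r.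
  by move=> t x i; rewrite hu M0 /wave !mul0r.
have aZ k : fpart (a 0 k) = 0.
  (* Periodicity between the origin and the [k]-th basis vector at time 0 says that Φ takes the same
     value at [a_k] and at 0. *)
  have := hu 0 (0 + delta_mx 0 k) k; rewrite torus_funP hu => /(mulfI M0).
  rewrite mulr0 !subr0 big1 => [|j _]; last by rewrite mxE mulr0.
  rewrite (bigD1 k)//= !mxE !eqxx add0r mulr1 big1 ?addr0 => [|j jk]; last first.
    by rewrite !mxE eqxx (negbTE jk) add0r mulr0.
  rewrite !peakon_profile_fpart [fpart 0](@fpart_def _ _ 0 0) ?lexx ?ltr01 ?addr0// => /esym.
  by apply: profile_eq0; rewrite fpart_ge0 fpart_lt1.
have [m am a0] := integral_unit_vector ha aZ.
have aE (x : 'rV[R]_d) : \sum_j a 0 j * x 0 j = a 0 m * x 0 m.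
  by rewrite (bigD1 m)//= big1 ?addr0// => j jm; rewrite a0// mul0r.
have CE : C = M * profile 0 * a 0 m.
  rewrite hC (bigD1 m)//= big1 ?addr0; last by move=> j jm; exact: a0.
  by rewrite profile0 [M * _]mulrC.
apply: (@wave_weak_solution R d m M (M * profile 0)) => // t x i.
rewrite hu aE CE /wave -peakon_profile_fpart; congr (_ * _).
(* If [a_m = -1], the speed [C] changes sign too, so the whole phase is reversed and evenness of Φ
   gives the same wave. *)
case: am => ->; rewrite ?mulr1 ?mul1r//.
by rewrite -peakon_profileN; congr peakon_profile; ring.
Qed.
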